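(* Let $d\ge1$. For each $N\in\mathbb{N}$ let $I^N\subseteq\mathbb{R}^d$ be measurable and let $(X^N_t)_{t\ge0}$ be a pure jump Markov process with values in $I^N$ and Lévy kernel $K^N(x,dy)$, $x\in I^N$. Let $S\subseteq\mathbb{R}^d$ be open and $S^N=I^N\cap S$. Set $m^N(x,\theta)=\int_{\mathbb{R}^d}e^{\langle\theta,y\rangle}K^N(x,dy)$ for $x\in S^N$, $\theta\in(\mathbb{R}^d)^*$. Assume: (i) for some $\eta_0>0$, $\ \sup_N\sup_{x\in S^N}\sup_{|\theta|\le\eta_0} m^N(x,N\theta)/N<\infty$; (ii) for some Lipschitz vector field $b$ on $S$, $\ \sup_{x\in S^N}|b^N(x)-b(x)|\to0$ as $N\to\infty$, where $b^N(x)=\frac{\partial m^N}{\partial\theta}(x,0)=\int_{\mathbb{R}^d} y\,K^N(x,dy)$; (iii) $x_0$ is a point of the closure $\bar S$ such that, for all $\delta>0$, $\ \limsup_{N\to\infty}N^{-1}\log\mathbb{P}(|X_0^N-x_0|>\delta)<0$. Let $\tilde b$ be a Lipschitz vector field on $\mathbb{R}^d$ extending $b$ and let $(x_t)_{t\ge0}$ be the unique solution of $\dot x_t=\tilde b(x_t)$ starting from $x_0$. Fix $t_0>0$ and set $T^N=\inf\{t\ge0:X^N_t\notin S\}\wedge t_0$. Then, for all $\delta>0$, $$\limsup_{N\to\infty}N^{-1}\log\mathbb{P}\Big(\sup_{t\le T^N}|X^N_t-x_t|>\delta\Big)<0.$$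
   Context: A pure jump Markov process $(X_t)_{t\ge0}$ with Lévy kernel $K$ is the right-continuous, piecewise constant Markov process which, when at $x$, makes jumps with displacement in $dy$ at rate $K(x,dy)$: the first jump time $T$ and displacement $\Delta X_T$ satisfy $\mathbb{P}(T\in dt,\Delta X_T\in dy\mid T>t,X_0=x)=K(x,dy)\,dt$. Convention: $\log 0=-\infty$. *)

(* Defs.v *)
From HB Require Import structures.
From mathcomp Require Import all_boot all_order all_algebra.
From mathcomp Require Import all_classical all_reals all_analysis.

Set Implicit Arguments.
Unset Strict Implicit.
Unset Printing Implicit Defensive.

Import Order.TTheory GRing.Theory Num.Theory.
Import numFieldNormedType.Exports.

Local Open Scope classical_set_scope.
Local Open Scope ring_scope.

(* The Borel sigma-algebra on R^d. *)
HB.instance Definition _ (R : realType) (d : nat) :=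
  @isMeasurable.Build (sigma_display (@open 'rV[R]_d)) 'rV[R]_d
    <<s @open 'rV[R]_d >>
    (@sigma_algebra0 _ setT (@open 'rV[R]_d))
    (@sigma_algebraC _ (@open 'rV[R]_d))
    (@sigma_algebra_bigcup _ setT (@open 'rV[R]_d)).

(* The pairing <u, v>; it also identifies the dual space (R^d)^* with row
   vectors. *)
Definition dotv (R : realType) (d : nat) (u v : 'rV[R]_d) : R :=
  \sum_i u 0 i * v 0 i.

(* Euclidean norm; the norm `|u| provided by the library on 'rV[R]_d is the
   supremum norm. *)
Definition enorm (R : realType) (d : nat) (u : 'rV[R]_d) : R :=
  Num.sqrt (dotv u u).

Definition lipschitz_field (R : realType) (d : nat) (A : set 'rV[R]_d)
    (f : 'rV[R]_d -> 'rV[R]_d) : Prop :=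
  exists L : R, forall x y, A x -> A y -> enorm (f x - f y) <= L * enorm (x - y).

(* Supremum of a set of nonnegative quantities, taken in [0, +oo]: it is 0
   (rather than -oo) on the empty set. *)
Definition nnsup (R : realType) (A : set (\bar R)) : \bar R :=
  ereal_sup (0%E |` A).

(* f : R -> R^d is only looked at on [0, +oo), hence the right derivative
   at 0. *)
Definition ode_solution (R : realType) (d : nat) (v : 'rV[R]_d -> 'rV[R]_d)
    (x0 : 'rV[R]_d) (f : R -> 'rV[R]_d) : Prop :=
  [/\ f 0 = x0,
      h^-1 *: (f h - f 0) @[h --> 0^'+] --> v (f 0) &
      forall t : R, 0 < t -> is_derive t 1 f (v (f t))].

Section pure_jump.
Context {R : realType} {d : nat}.

(* The second clause gives left limits that are attained before t, so that
   there are finitely many jumps in every bounded time interval. *)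
Definition step_path (f : R -> 'rV[R]_d) : Prop :=
  (forall t, 0 <= t -> \forall u \near t^'+, f u = f t) /\
  (forall t, 0 < t -> exists c, \forall u \near t^'-, f u = c).

Context {disp : measure_display} {Omega : measurableType disp}.
Implicit Types (X : R -> Omega -> 'rV[R]_d) (w : Omega).

Definition history X (s : R) : set (set Omega) :=
  <<s \bigcup_(u in `[0, s]) preimage_set_system setT (X u) measurable >>.

(* Time elapsed between s and the first jump after s (+oo if X never jumps
   after s). *)
Definition jump_wait X (s : R) w : \bar R :=
  ereal_inf [set u%:E | u in [set u : R | 0 < u /\ X (s + u) w <> X s w]].

(* Meaningful when jump_wait X s w is finite. *)
Definition jump_displacement X (s : R) w : 'rV[R]_d :=
  X (s + fine (jump_wait X s w)) w - X s w.

(* X is a pure jump Markov process with values in I and Levy kernel K. Only the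
   restriction of K to I matters. With T and D the waiting time and the
   displacement of the first jump after s, pjm_rates is the integrated form of
     P(T \in du, D \in dy | T > u, history up to s) = K(X_s, dy) du,
   that is, of the law of the first jump for the process restarted from X_s.
   It forces, almost surely, K(X_s, .) to be finite and to give no mass
   to {0}. *)
Record pure_jump_markov (P : probability Omega R) (I : set 'rV[R]_d)
    (K : R.-ker 'rV[R]_d ~> 'rV[R]_d) X : Prop := PureJumpMarkov {
  pjm_measurable : forall t, 0 <= t -> measurable_fun setT (X t) ;
  pjm_values : forall t w, 0 <= t -> I (X t w) ;
  pjm_paths : forall w, step_path (X ^~ w) ;
  pjm_markov : exists p : R -> R.-pker 'rV[R]_d ~> 'rV[R]_d,
    forall (s t : R) (A : set Omega) (B : set 'rV[R]_d),
      0 <= s -> 0 <= t -> history X s A -> measurable B ->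
      P (A `&` X (s + t) @^-1` B) = (\int[P]_(w in A) p t (X s w) B)%E ;
  pjm_rates : forall (s t : R) (A : set Omega) (B : set 'rV[R]_d),
    0 <= s -> 0 <= t -> history X s A -> measurable B ->
      P (A `&` [set w | (jump_wait X s w <= t%:E)%E
                        /\ B (jump_displacement X s w)]) =
      (\int[lebesgue_measure]_(u in `[0%R, t])
         \int[P]_(w in A `&` [set w | u%:E < jump_wait X s w]) K (X s w) B)%E
}.

End pure_jump.

Section transforms.
Context {R : realType} {d : nat}.
Implicit Types (K : R.-ker 'rV[R]_d ~> 'rV[R]_d) (x theta : 'rV[R]_d).

Definition laplace K x theta : \bar R :=
  (\int[K x]_y (expR (dotv theta y))%:E)%E.

Definition drift K x : 'rV[R]_d :=
  \row_i Rintegral (K x) setT (fun y : 'rV[R]_d => y 0 i).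

End transforms.

(* inf {t >= 0 : f t \notin S} /\ t0, with inf set0 = +oo *)
Definition exit_time (R : realType) (d : nat) (S : set 'rV[R]_d) (t0 : R)
    (f : R -> 'rV[R]_d) : \bar R :=
  Order.min
    (ereal_inf [set t%:E | t in [set t : R | 0 <= t /\ ~ S (f t)]]) t0%:E.

(* Main.v *)
Require Import Defs.
From HB Require Import structures.
From mathcomp Require Import all_boot all_order all_algebra ring lra.
From mathcomp Require Import all_classical all_reals all_analysis measurable_realfun.

Set Implicit Arguments.
Unset Strict Implicit.
Unset Printing Implicit Defensive.

Import Order.TTheory GRing.Theory Num.Theory.
Import numFieldNormedType.Exports.

Local Open Scope classical_set_scope.
Local Open Scope ring_scope.

(* The stopped process is controlled by the exponential Lyapunov function
   exp (N a psi (X_t - x_t)), where psi u = sqrt (e^2 + |u|^2) and the weight a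
   decreases like exp (- L t), which absorbs the Lipschitz growth of the drift.
   While the process is in S, a second order expansion of psi and the
   exponential moments of the kernel show that the logarithm of its expectation
   grows at rate at most N a eps + O(N a^2) + O(1), so that for a small it does
   not compensate the factor exp (N a exp (- L t0) delta / 2) gained on the event
   where the deviation exceeds delta / 2.  No continuous-time martingale is
   needed: on a grid of mesh h, the law of the first jump in a cell determines
   the evolution over the cell up to O(h^2), as long as the cell contains at most
   one jump; and for a given path all cells have this property when the grid is
   fine enough, so that the probability of the event is at most the lower limit
   of the probabilities of its discretizations. *)

(** * The smoothed Euclidean norm *)

Section euclidean.
Context {R : realType} {d : nat}.
Implicit Types (u v w y : 'rV[R]_d) (e : R).

(** The law of the process is only given through the first jump after a time [s], integrated over
    events of the history up to [s]. This controls functions of the displacement alone, whereas the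
    Lyapunov function depends on [X_s] as well. Hence each history event is cut into countably many
    pieces on which [X_s] is almost constant; the error is arbitrarily small and is absorbed in a
    strict inequality between rates. Smoothing the norm serves three purposes: convexity transports
    the gradient term along [x] without a second order error, the Lipschitz bound controls the
    exponents, and the bound [1 / e] on the Hessian keeps its contribution to the rate bounded in
    [N]. The [O(N a^2)] term is beaten by the gain, linear in [a], once [a] is small but fixed. The
    bound obtained on a fine grid does not depend on its mesh: the errors of order [h^2] per cell
    add up to at most the length of the time interval in the exponent. *)

Lemma dotvC u v : dotv u v = dotv v u.
Proof. by apply: eq_bigr => i _; rewrite mulrC. Qed.

Lemma dotvDr u v w : dotv u (v + w) = dotv u v + dotv u w.
Proof. by rewrite -big_split; apply: eq_bigr => i _; rewrite mxE mulrDr. Qed.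

Lemma dotvZr (c : R) u v : dotv u (c *: v) = c * dotv u v.
Proof. by rewrite mulr_sumr; apply: eq_bigr => i _; rewrite mxE mulrCA. Qed.

Lemma dotvZl (c : R) u v : dotv (c *: u) v = c * dotv u v.
Proof. by rewrite dotvC dotvZr dotvC. Qed.

Lemma dotvDl u v w : dotv (u + v) w = dotv u w + dotv v w.
Proof. by rewrite dotvC dotvDr !(dotvC w). Qed.

Lemma dotvNr u v : dotv u (- v) = - dotv u v.
Proof. by rewrite -scaleN1r dotvZr mulN1r. Qed.

Lemma dotvBr u v w : dotv u (v - w) = dotv u v - dotv u w.
Proof. by rewrite dotvDr dotvNr. Qed.

Lemma dotv_ge0 u : 0 <= dotv u u.
Proof. by apply: sumr_ge0 => i _; rewrite -expr2 sqr_ge0. Qed.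

Lemma enorm_ge0 u : 0 <= enorm u. Proof. exact: sqrtr_ge0. Qed.

Lemma sqr_enorm u : enorm u ^+ 2 = dotv u u.
Proof. by rewrite sqr_sqrtr// dotv_ge0. Qed.

Lemma enormZ (c : R) u : enorm (c *: u) = `|c| * enorm u.
Proof.
by rewrite /enorm dotvZl dotvZr mulrA -expr2 sqrtrM ?sqr_ge0// sqrtr_sqr.
Qed.

Lemma enormN u : enorm (- u) = enorm u.
Proof. by rewrite -scaleN1r enormZ normrN1 mul1r. Qed.

Lemma enormB u v : enorm (u - v) = enorm (v - u).
Proof. by rewrite -enormN opprB. Qed.

Lemma enorm0 : enorm (0 : 'rV[R]_d) = 0.
Proof. by rewrite -(scale0r 0) enormZ normr0 mul0r. Qed.

Lemma enorm_coord u i : `|u 0 i| <= enorm u.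
Proof.
rewrite -sqrtr_sqr ler_wsqrtr// /dotv (bigD1 i)//= -expr2 lerDl.
by apply: sumr_ge0 => j _; rewrite -expr2 sqr_ge0.
Qed.

Lemma enorm_le_sum u : enorm u <= \sum_i `|u 0 i|.
Proof.
have S0 : 0 <= \sum_i `|u 0 i| by apply: sumr_ge0.
rewrite -(ler_pXn2r (n := 2))// ?nnegrE ?enorm_ge0// sqr_enorm expr2 mulr_sumr.
apply: ler_sum => i _; rewrite -expr2 -real_normK ?num_real// expr2.
rewrite ler_wpM2r// (bigD1 i)//= lerDl; exact: sumr_ge0.
Qed.

(** Cauchy-Schwarz, from the squared norm of [enorm v *: u - enorm u *: v]; dividing by the norms
    requires treating null vectors apart. *)
Lemma dotv_le u v : dotv u v <= enorm u * enorm v.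
Proof.
have [u0|u0] := eqVneq (enorm u) 0.
  have ui i : u 0 i = 0.
    by apply/eqP; rewrite -normr_eq0 eq_le normr_ge0 andbT -u0 enorm_coord.
  by rewrite u0 mul0r /dotv big1// => i _; rewrite ui mul0r.
have [v0|v0] := eqVneq (enorm v) 0.
  have vi i : v 0 i = 0.
    by apply/eqP; rewrite -normr_eq0 eq_le normr_ge0 andbT -v0 enorm_coord.
  by rewrite v0 mulr0 /dotv big1// => i _; rewrite vi mulr0.
have pu : 0 < enorm u by rewrite lt_def u0 enorm_ge0.
have pv : 0 < enorm v by rewrite lt_def v0 enorm_ge0.
have := dotv_ge0 (enorm v *: u - enorm u *: v).
rewrite dotvBr !(dotvC (_ - _)) !dotvBr !dotvZl !dotvZr -!sqr_enorm (dotvC v u).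
rewrite (_ : _ - _ =
  (2 * enorm u * enorm v) * (enorm u * enorm v - dotv u v)); last by ring.
by rewrite pmulr_rge0 ?subr_ge0// !mulr_gt0.
Qed.

Lemma ler_norm_dotv u v : `|dotv u v| <= enorm u * enorm v.
Proof. by rewrite ler_norml dotv_le andbT lerNl -dotvNr -(enormN v) dotv_le. Qed.

Lemma ler_enormD u v : enorm (u + v) <= enorm u + enorm v.
Proof.
rewrite -(ler_pXn2r (n := 2))// ?nnegrE ?addr_ge0 ?enorm_ge0//.
rewrite sqrrD !sqr_enorm dotvDl !dotvDr (dotvC v u).
have := dotv_le u v; lra.
Qed.

Lemma ler_enormB u v : enorm u <= enorm v + enorm (u - v).
Proof. by rewrite -{1}(subrK v u) addrC ler_enormD. Qed.

(* A smooth approximation of the Euclidean norm: it is convex and 1-Lipschitz,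
   and its Hessian is at most 1 / e. *)
Definition psi e u : R := Num.sqrt (e ^+ 2 + dotv u u).

Lemma psi_ge0 e u : 0 <= psi e u. Proof. exact: sqrtr_ge0. Qed.

Lemma sqr_psi e u : psi e u ^+ 2 = e ^+ 2 + dotv u u.
Proof. by rewrite sqr_sqrtr// addr_ge0 ?dotv_ge0 ?sqr_ge0. Qed.

Lemma psi_ge e u : 0 <= e -> e <= psi e u.
Proof.
move=> e0; rewrite -{1}(ger0_norm e0) -sqrtr_sqr ler_wsqrtr// lerDl.
exact: dotv_ge0.
Qed.

Lemma psi_gt0 e u : 0 < e -> 0 < psi e u.
Proof. by move=> e0; apply: lt_le_trans (psi_ge u (ltW e0)). Qed.

Lemma enorm_le_psi e u : enorm u <= psi e u.
Proof. by rewrite ler_wsqrtr// lerDr sqr_ge0. Qed.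

Lemma psi_le e u : 0 <= e -> psi e u <= e + enorm u.
Proof.
move=> e0; rewrite -(ler_pXn2r (n := 2))// ?nnegrE ?addr_ge0 ?enorm_ge0 ?psi_ge0//.
rewrite sqr_psi sqrrD sqr_enorm.
have := mulr_ge0 e0 (enorm_ge0 u); lra.
Qed.

(** Concavity of the square root: [2 psi(u) psi(u + y) <= psi(u)^2 + psi(u + y)^2], whose right-hand
    side is an exact quadratic polynomial in [y]. The factor [1 / e] comes from [psi e u >= e]. *)
Lemma psi_taylor e u y : 0 < e ->
  psi e (u + y) <= psi e u + dotv u y / psi e u + enorm y ^+ 2 / (2 * e).
Proof.
move=> e0; have p0 := psi_gt0 u e0.
apply: (@le_trans _ _ (psi e u + dotv u y / psi e u + enorm y ^+ 2 / (2 * psi e u))).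
  rewrite -(ler_pM2l (_ : 0 < 2 * psi e u)) ?mulr_gt0//.
  rewrite (_ : _ * (_ + _ + _) =
    2 * psi e u ^+ 2 + 2 * dotv u y + enorm y ^+ 2); last first.
    by field; rewrite gt_eqF.
  have := sqr_ge0 (psi e u - psi e (u + y)); rewrite sqrrB !sqr_psi sqr_enorm.
  rewrite dotvDl !dotvDr (dotvC y u); lra.
rewrite lerD2l ler_wpM2l ?sqr_ge0// lef_pV2 ?posrE ?mulr_gt0//.
by rewrite ler_pM2l// psi_ge// ltW.
Qed.

(** Multiplied by [psi e u], this is Cauchy-Schwarz for the vectors [(e, u)] and [(e, u + v)] of
    dimension [d + 1]. *)
Lemma psi_convex e u v : 0 < e -> psi e u + dotv u v / psi e u <= psi e (u + v).
Proof.
move=> e0; have p0 := psi_gt0 u e0; have q0 := psi_gt0 (u + v) e0.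
rewrite -(ler_pM2l p0) mulrDr (mulrC _ (_ / _)) divfK ?gt_eqF// -expr2 sqr_psi.
rewrite -addrA -dotvDr.
have [neg|pos] := leP (e ^+ 2 + dotv u (u + v)) 0.
  by apply: le_trans neg _; rewrite mulr_ge0 ?psi_ge0.
rewrite -(ler_pXn2r (n := 2))// ?nnegrE ?mulr_ge0 ?psi_ge0 ?(ltW pos)//.
rewrite exprMn !sqr_psi -subr_ge0.
have cs : dotv u (u + v) ^+ 2 <= dotv u u * dotv (u + v) (u + v).
  rewrite -!sqr_enorm -exprMn -real_normK ?num_real//.
  by rewrite ler_pXn2r ?nnegrE ?mulr_ge0 ?enorm_ge0// ler_norm_dotv.
have := mulr_ge0 (sqr_ge0 e) (dotv_ge0 (u - (u + v))).
rewrite dotvBr !(dotvC (_ - _)) !dotvBr (dotvC (u + v) u) => h.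
rewrite (_ : _ - _ =
  e ^+ 2 * (dotv u u - dotv u (u + v) - (dotv u (u + v) - dotv (u + v) (u + v))) +
  (dotv u u * dotv (u + v) (u + v) - dotv u (u + v) ^+ 2)); last by ring.
by rewrite addr_ge0// subr_ge0.
Qed.

Lemma psi_lipschitz e u y : 0 < e -> psi e (u + y) <= psi e u + enorm y.
Proof.
move=> e0; have p0 := psi_gt0 u e0.
rewrite -(ler_pXn2r (n := 2))// ?nnegrE ?addr_ge0 ?enorm_ge0 ?psi_ge0//.
rewrite sqr_psi sqrrD sqr_psi sqr_enorm dotvDl !dotvDr (dotvC y u).
have := dotv_le u y.
have := ler_wpM2r (enorm_ge0 y) (enorm_le_psi e u); lra.
Qed.

Lemma psi_dist e u y : 0 < e -> `|psi e (u + y) - psi e u| <= enorm y.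
Proof.
move=> e0; rewrite ler_norml; apply/andP; split; last first.
  by rewrite lerBlDl psi_lipschitz.
by have := psi_lipschitz (u + y) (- y) e0; rewrite addrK enormN; lra.
Qed.

Lemma dotv_psi_le e u v : 0 < e -> dotv u v / psi e u <= enorm v.
Proof.
move=> e0; rewrite ler_pdivrMr ?psi_gt0//.
apply: le_trans (dotv_le u v) _.
by rewrite mulrC ler_wpM2l ?enorm_ge0 ?enorm_le_psi.
Qed.

End euclidean.

(** * Elementary inequalities for the exponential *)

Section scalar.
Context {R : realType}.
Implicit Types z r a s : R.

Lemma expR_taylor z : expR z <= 1 + z + z ^+ 2 * expR `|z|.
Proof.
have zexp (x : R) : expR x - 1 <= x * expR x.
  have := expR_ge1Dx (- x); rewrite expRN -(ler_pM2r (expR_gt0 x)).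
  by rewrite mulVf ?gt_eqF ?expR_gt0//; lra.
have [z0|z0] := leP 0 z.
  by have := ler_wpM2l z0 (zexp z); have := zexp z; rewrite (ger0_norm z0); lra.
have h1 := zexp z.
have h2 : z * (expR z - 1) <= z * z.
  by rewrite ler_nM2l//; have := expR_ge1Dx z; lra.
have h3 : z ^+ 2 * 1 <= z ^+ 2 * expR `|z|.
  by rewrite ler_wpM2l ?sqr_ge0// -expR0 ler_expR.
lra.
Qed.

(** Half of the exponent [s * r] pays for [expR (a * r)]. The other half pays for [r ^+ 2]: squaring
    [s * r / 4 <= expR (s * r / 4)] gives the constant 16. *)
Lemma sqr_expR_le r a s : 0 <= r -> 0 < s -> a <= s / 2 ->
  r ^+ 2 * expR (a * r) <= 16 / s ^+ 2 * expR (s * r).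
Proof.
move=> r0 s0 as2.
have h : r ^+ 2 <= 16 / s ^+ 2 * expR (s * r / 2).
  rewrite mulrAC ler_pdivlMr ?exprn_gt0//.
  rewrite (_ : s * r / 2 = s * r / 4 + s * r / 4); last by field.
  rewrite expRD -expr2 (_ : 16 = 4 ^+ 2); last by ring.
  have sr0 : 0 <= s * r by rewrite mulr_ge0// ltW.
  rewrite -!exprMn ler_pXn2r ?nnegrE ?mulr_ge0 ?expR_ge0// ?(ltW s0)//.
  have := expR_ge1Dx (s * r / 4); lra.
rewrite (_ : expR (s * r) = expR (s * r / 2 + s * r / 2)); last first.
  by congr expR; field.
rewrite expRD mulrA ler_pM ?sqr_ge0 ?expR_ge0//.
rewrite ler_expR; have := ler_wpM2r r0 as2; lra.
Qed.

End scalar.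

(** * Borel sets of row vectors *)

Section measurable_extra.
Context dT (T : measurableType dT) (R : realType).

Lemma countable_bigcup_measurable (I : choiceType) (D : set I) (F : I -> set T) :
  countable [set: I] -> (forall i, D i -> measurable (F i)) ->
  measurable (\bigcup_(i in D) F i).
Proof.
move=> cI mF; rewrite bigcup_mkcond; apply: countable_bigcupT_measurable => // i.
by case: ifPn => // /[!inE]; exact: mF.
Qed.

Lemma countable_bigcap_measurable (I : choiceType) (D : set I) (F : I -> set T) :
  countable [set: I] -> (forall i, D i -> measurable (F i)) ->
  measurable (\bigcap_(i in D) F i).
Proof.
move=> cI mF; rewrite -[X in measurable X]setCK setC_bigcap; apply: measurableC.
by apply: countable_bigcup_measurable => // i Di; exact/measurableC/mF.
Qed.

Lemma measurable_lt_set (f g : T -> R) :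
  measurable_fun setT f -> measurable_fun setT g ->
  measurable [set w | f w < g w].
Proof.
move=> mf mg; rewrite -[X in measurable X]setTI.
exact: (measurable_fun_ltr mf mg measurableT (_ : measurable [set true])).
Qed.

Lemma measurable_le_set (f g : T -> R) :
  measurable_fun setT f -> measurable_fun setT g ->
  measurable [set w | f w <= g w].
Proof.
move=> mf mg; rewrite -[X in measurable X]setTI.
exact: (measurable_fun_ler mf mg measurableT (_ : measurable [set true])).
Qed.

End measurable_extra.

Section borel_rV.
Context {R : realType} {d : nat}.
Implicit Types (u v : 'rV[R]_d).

Lemma open_measurable_rV (U : set 'rV[R]_d) : open U -> measurable U.
Proof. by move=> oU; exact: sub_sigma_algebra. Qed.

Lemma continuous_measurable_rV (f : 'rV[R]_d -> R) :
  continuous f -> measurable_fun setT f.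
Proof.
move=> cf; apply: (measurability _ (RGenOpens.measurableE R)) => //.
move=> _ [_ [a [b ->] <-]]; rewrite setTI.
apply: open_measurable_rV; move/continuousP : cf; apply.
exact: interval_open.
Qed.

Lemma measurable_coord i : measurable_fun setT (fun u : 'rV[R]_d => u 0 i).
Proof. by apply: continuous_measurable_rV; exact: coord_continuous. Qed.

Definition ratrV (q : 'rV[rat]_d) : 'rV[R]_d := map_mx ratr q.

Lemma ratrV_dense u (r : R) : 0 < r -> exists q, forall i, `|u 0 i - ratrV q 0 i| < r.
Proof.
move=> r0.
have H i : exists q : rat, `|u 0 i - ratr q| < r.
  have /rat_in_itvoo[q] : u 0 i - r < u 0 i + r by lra.
  rewrite in_itv/= => /andP[h1 h2]; exists q.
  by rewrite distrC ltr_distl; apply/andP.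
exists (\row_i projT1 (cid (H i))) => i; rewrite !mxE.
by case: cid.
Qed.

(* The Borel sets of 'rV_d are generated by countably many boxes, so
   measurability can be checked coordinatewise. *)
Lemma measurable_fun_rV dT (T : measurableType dT) (F : T -> 'rV[R]_d) :
  (forall i, measurable_fun setT (fun w => F w 0 i)) -> measurable_fun setT F.
Proof.
move=> mF; apply: (measurability (@open 'rV[R]_d)) => //.
move=> _ [U oU <-]; rewrite setTI.
pose box (p : 'rV[rat]_d * nat) :=
  [set u : 'rV[R]_d | forall i, `|u 0 i - ratrV p.1 0 i| < p.2.+1%:R^-1].
have mbox p : measurable (F @^-1` box p).
  rewrite (_ : _ @^-1` _ = \bigcap_i
      [set w | `|F w 0 i - ratrV p.1 0 i| < p.2.+1%:R^-1]); last first.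
    by apply/seteqP; split=> w /= H i; [move=> _|]; exact: H.
  apply: countable_bigcap_measurable => [|i _]; first exact: countableP.
  apply: measurable_lt_set => //; apply: measurableT_comp => //.
  exact: measurable_funB (mF i) (measurable_cst _).
rewrite (_ : F @^-1` U = \bigcup_(p in [set p | box p `<=` U]) F @^-1` box p).
  by apply: countable_bigcup_measurable => [|p _]; [exact: countableP|exact: mbox].
apply/seteqP; split => [w Uw|w [p /= pU wp]]; last exact: pU.
have /nbhs_ballP[e /= e0 eU] : nbhs (F w) U by apply: open_nbhs_nbhs; split.
have [n ne] : exists n : nat, n.+1%:R^-1 < e / 2.
  have /ltr_add_invr[n] : 0 < e / 2 by rewrite divr_gt0.
    by rewrite add0r => ne; exists n.
have [q qe] := @ratrV_dense (F w) n.+1%:R^-1 ltac:(by rewrite invr_gt0).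
exists (q, n) => //= u uq; apply: eU; split=> // i j; rewrite (ord1 i).
rewrite /ball/= (splitr e) -(subrKA (ratrV q 0 j)) (le_lt_trans (ler_normD _ _))//.
by rewrite ltrD// ?(lt_trans _ ne)// ?qe// distrC uq.
Qed.

Lemma measurable_sub dT (T : measurableType dT) (F G : T -> 'rV[R]_d) :
  measurable_fun setT F -> measurable_fun setT G ->
  measurable_fun setT (fun w => F w - G w).
Proof.
move=> mF mG; apply: measurable_fun_rV => i.
rewrite (_ : (fun _ => _) = (fun w => F w 0 i - G w 0 i)); last first.
  by apply/funext => w; rewrite !mxE.
by apply: measurable_funB; apply: measurableT_comp (measurable_coord i) _.
Qed.

Lemma measurable_add dT (T : measurableType dT) (F G : T -> 'rV[R]_d) :
  measurable_fun setT F -> measurable_fun setT G ->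
  measurable_fun setT (fun w => F w + G w).
Proof.
move=> mF mG; apply: measurable_fun_rV => i.
rewrite (_ : (fun _ => _) = (fun w => F w 0 i + G w 0 i)); last first.
  by apply/funext => w; rewrite !mxE.
by apply: measurable_funD; apply: measurableT_comp (measurable_coord i) _.
Qed.

Lemma measurable_set1_rV u : measurable [set u].
Proof.
rewrite -[X in measurable X]setCK; apply: measurableC; apply: open_measurable_rV.
rewrite openC; apply: accessible_closed_set1; exact: hausdorff_accessible.
Qed.

Lemma measurable_eq_rV dT (T : measurableType dT) (F G : T -> 'rV[R]_d) :
  measurable_fun setT F -> measurable_fun setT G ->
  measurable [set w | F w = G w].
Proof.
move=> mF mG.
rewrite (_ : [set _ | _] = (fun w => F w - G w) @^-1` [set 0]).
  rewrite -[X in measurable X]setTI; apply: measurable_sub => //.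
  exact: measurable_set1_rV.
by apply/seteqP; split => w /= => [->|/eqP]; rewrite ?subrr// subr_eq0 => /eqP.
Qed.

Lemma measurable_dotv dT (T : measurableType dT) (F G : T -> 'rV[R]_d) :
  measurable_fun setT F -> measurable_fun setT G ->
  measurable_fun setT (fun w => dotv (F w) (G w)).
Proof.
move=> mF mG; rewrite /dotv; apply: measurable_sum => i.
by apply: measurable_funM; apply: measurableT_comp (measurable_coord i) _.
Qed.

Lemma measurable_sqrt : measurable_fun setT (@Num.sqrt R).
Proof. by apply: continuous_measurable_fun; exact: sqrt_continuous. Qed.

Lemma measurable_enorm dT (T : measurableType dT) (F : T -> 'rV[R]_d) :
  measurable_fun setT F -> measurable_fun setT (fun w => enorm (F w)).
Proof.
by move=> mF; apply: measurableT_comp measurable_sqrt _; exact: measurable_dotv.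
Qed.

Lemma measurable_psi dT (T : measurableType dT) (F : T -> 'rV[R]_d) e :
  measurable_fun setT F -> measurable_fun setT (fun w => psi e (F w)).
Proof.
move=> mF; apply: measurableT_comp measurable_sqrt _.
by apply: measurable_funD => //; exact: measurable_dotv.
Qed.

End borel_rV.

Section integral_extra.
Context d1 (T : measurableType d1) (R : realType).
Variable mu : {measure set T -> \bar R}.
Local Open Scope ereal_scope.

(* Unlike in [ge0_le_integral], the functions need not be measurable. *)
Lemma ge0_le_integral_nomeas (D : set T) (f g : T -> \bar R) :
  (forall x, D x -> 0 <= f x) -> (forall x, D x -> f x <= g x) ->
  \int[mu]_(x in D) f x <= \int[mu]_(x in D) g x.
Proof.
move=> f0 fg.
rewrite ge0_integralE// [leRHS]ge0_integralE//; last first.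
  by move=> x Dx; exact: le_trans (f0 _ Dx) (fg _ Dx).
apply: ge_ereal_sup => _ [h/= hf] <-; apply: ereal_sup_ubound; exists h => //= x.
apply: le_trans (hf x) _; rewrite /patch; case: ifPn => // /[!inE] Dx; exact: fg.
Qed.

End integral_extra.

(** * Step paths and their first jumps *)

(** Events about a whole path are decided by its values on any grid that is fine enough, how fine
    depending on the path; they are thus lower limits of grid events. *)
Lemma measurable_eventually (dT : measure_display) (T : measurableType dT)
    (C : nat -> set T) (A : set T) :
  (forall n, measurable (C n)) ->
  (forall w, A w <-> \forall n \near \oo, C n w) -> measurable A.
Proof.
move=> mC CA; rewrite (_ : A = \bigcup_m \bigcap_(n in [set n | (m <= n)%N]) C n).
  by apply: bigcup_measurable => m _; exact: bigcap_measurableType.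
apply/seteqP; split => [w /CA[m _ mC']|w [m _ mC']]; first by exists m.
by apply/CA; exists m.
Qed.

Lemma natSinv_lt (R : realType) (e : R) : 0 < e ->
  \forall n \near \oo, n.+1%:R^-1 < e.
Proof.
move=> e0; exact: (near_infty_natSinv_lt (PosNum e0)).
Qed.

Lemma grid_cell (R : realType) (h u : R) (n : nat) : 0 < u -> u <= h ->
  exists2 k, (k < n.+1)%N & k%:R * (h / n.+1%:R) < u <= k.+1%:R * (h / n.+1%:R).
Proof.
move=> u0 uh.
have c0 : 0 < h / n.+1%:R by rewrite divr_gt0// (lt_le_trans u0).
have Pn : u <= n.+1%:R * (h / n.+1%:R).
  by rewrite mulrC divfK.
have ex : exists k, u <= k%:R * (h / n.+1%:R) by exists n.+1.
case: (ex_minnP ex) => -[|k] uk kmin; first by move: uk; rewrite mul0r leNgt u0.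
exists k; first exact: kmin.
rewrite uk andbT ltNge; apply/negP => /kmin; by rewrite ltnn.
Qed.

Section step_paths.
Context {R : realType} {d : nat}.
Variable f : R -> 'rV[R]_d.
Hypothesis fstep : step_path f.

Lemma step_path_right t : 0 <= t ->
  exists2 e : R, 0 < e & forall u : R, t <= u < t + e -> f u = f t.
Proof.
move=> t0; have [H _] := fstep.
have /nbhs_ballP[e /= e0 eH] := H t t0.
exists e => // u /andP[tu ut]; have [->//|neq] := eqVneq u t.
apply: eH; last by rewrite lt_def neq.
by rewrite /ball/= distrC ger0_norm ?subr_ge0// ltrBlDl.
Qed.

Lemma step_path_left t : 0 <= t ->
  exists c, exists2 e : R, 0 < e & forall u : R, 0 <= u -> t - e < u < t -> f u = c.
Proof.
rewrite le_eqVlt => /predU1P[<-|t0].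
  (* No nonnegative time precedes 0, so the value [0] and the width [1] are arbitrary. *)
  by exists 0, 1 => // u u0 /andP[_]; rewrite ltNge u0.
have [_ H] := fstep; have [c /nbhs_ballP[e /= e0 eH]] := H t t0.
exists c, e => // u u0 /andP[tu ut]; apply: eH => //.
by rewrite /ball/= gtr0_norm ?subr_gt0// ltrBlDl -ltrBlDr.
Qed.

(** Compactness of [[a, b]]: around each time [x] the path has one value just before [x] and one
    from [x] on, so [u] shares its value with [t] if [x <= u] and with [s] otherwise. *)
Lemma step_path_mesh a b : 0 <= a ->
  exists2 r : R, 0 < r & forall s u t : R, a <= s -> s <= u -> u <= t -> t <= b ->
    t - s <= r -> f u = f s \/ f u = f t.
Proof.
move=> a0.
pose Q (n : nat) (s : R) := a <= s -> forall u t, s <= u -> u <= t -> t <= b ->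
  t - s <= n.+1%:R^-1 -> f u = f s \/ f u = f t.
have cov : \forall n \near \oo, `[a, b] `<=` Q n.
  apply: ((compact_near_coveringP _).1 (@segment_compact R a b)) => x.
  rewrite /= in_itv/= => /andP[ax xb]; have x0 := le_trans a0 ax.
  have [e e0 He] := step_path_right x0.
  have [c [e' e0' Hc]] := step_path_left x0.
  have [m [m0 me me']] : exists m, [/\ 0 < m, m + m <= e & m + m <= e'].
    exists (Num.min e e' / 2); rewrite -splitr !ge_min !lexx orbT; split => //.
    by rewrite divr_gt0// lt_min e0.
  near=> s n => /= as_ u t su ut tb ts.
  have nm : n.+1%:R^-1 < m by near: n; exact: natSinv_lt.
  have {nm}tsm := le_lt_trans ts nm.
  have xs : `|x - s| < m.
    by near: s; apply/nbhs_ballP; exists m.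
  move: xs; rewrite ltr_distlC => /andP[xs1 xs2].
  have s0 := le_trans a0 as_.
  have [xu|ux] := leP x u.
    by right; rewrite (He u) 1?(He t)//; apply/andP; split; lra.
  by left; rewrite (Hc u) 1?(Hc s)//; first [apply/andP; split; lra | lra].
have [n] := @filter_ex _ _ _ _ cov.
move=> nQ; exists n.+1%:R^-1; first by rewrite invr_gt0.
move=> s u t as_ su ut tb ts; apply: (nQ s) => //=.
by rewrite in_itv/= as_/= (le_trans su)// (le_trans ut).
Unshelve. all: by end_near. Qed.

(** By right-continuity the value at [s + u] is still taken at some [s + ratr q * h] slightly later;
    the endpoint [u = h] has no room on its right and is immediate. This reduces the condition to
    countably many times. *)
Lemma one_jump_rat s h : 0 <= s -> 0 < h ->
  (forall q : rat, 0 <= q <= 1 -> f (s + ratr q * h) = f s \/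
                                 f (s + ratr q * h) = f (s + h)) <->
  (forall u, 0 <= u <= h -> f (s + u) = f s \/ f (s + u) = f (s + h)).
Proof.
move=> s0 h0; split=> H; last first.
  move=> q /andP[q0 q1]; apply: H; rewrite mulr_ge0 ?ler0q ?(ltW h0)//=.
  by rewrite ler_piMl ?(ltW h0)// -(rmorph1 (ratr : rat -> R)) ler_rat.
move=> u /andP[u0]; rewrite le_eqVlt => /predU1P[->|uh]; first by right.
have [e e0 He] := @step_path_right (s + u) ltac:(by rewrite addr_ge0).
have /rat_in_itvoo[q] : u / h < Num.min ((u + e) / h) 1.
  by rewrite lt_min ltr_pM2r ?invr_gt0// ltrDl e0/= ltr_pdivrMr// mul1r.
rewrite in_itv/= lt_min ltr_pdivrMr// ltr_pdivlMr// => /andP[q1 /andP[q2 q3]].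
have q0 : 0 <= q.
  by rewrite -(ler0q R) -(pmulr_lge0 _ h0) (le_trans u0)// ltW.
rewrite -(He (s + ratr q * h)); last first.
  by rewrite lerD2l (ltW q1)/= -addrA ltrD2l.
apply: H; rewrite q0/= -(ler_rat R) rmorph1; exact: ltW.
Qed.

End step_paths.

Section jumps.
Context {R : realType} {d : nat} {disp : measure_display}
  {Omega : measurableType disp}.
Variable X : R -> Omega -> 'rV[R]_d.
Hypothesis Xstep : forall w, step_path (X ^~ w).
Implicit Types (s t h u : R) (w : Omega).

Lemma jump_wait_le s u w : 0 < u -> X (s + u) w <> X s w ->
  (jump_wait X s w <= u%:E)%E.
Proof. by move=> u0 neq; apply: ereal_inf_lbound; exists u. Qed.

Lemma jump_wait_ge s u w : (forall v, 0 <= v < u -> X (s + v) w = X s w) ->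
  (u%:E <= jump_wait X s w)%E.
Proof.
move=> H; apply: le_ereal_inf_tmp => _ [v [v0 neq] <-].
by rewrite lee_fin leNgt; apply/negP => vu; apply/neq/H; rewrite (ltW v0).
Qed.

Lemma jump_wait_gt0 s w : 0 <= s -> (0 < jump_wait X s w)%E.
Proof.
move=> s0; have [e e0 He] := step_path_right (Xstep w) s0.
apply: (@lt_le_trans _ _ e%:E); first by rewrite lte_fin.
by apply: jump_wait_ge => v /andP[v0 ve]; apply: He; rewrite lerDl v0 ltrD2l.
Qed.

(** The infimum is attained: if the path still had its initial value at time [s + r],
    right-continuity would keep it there a little longer. *)
Lemma jump_waitP s t w : 0 <= s -> (jump_wait X s w <= t%:E)%E ->
  exists r, [/\ jump_wait X s w = r%:E, 0 < r <= t, X (s + r) w <> X s w &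
    forall u, 0 <= u < r -> X (s + u) w = X s w].
Proof.
move=> s0; have := jump_wait_gt0 w s0.
case E : (jump_wait X s w) => [r||]//; rewrite lee_fin lte_fin => r0 rt.
have before u : 0 <= u < r -> X (s + u) w = X s w.
  move=> /andP[u0 ur]; apply: contrapT => neq.
  have [u0'|] := ltP 0 u; last first.
    by move=> u0'; apply: neq; rewrite (_ : u = 0) ?addr0//; apply/le_anti/andP.
  by have := jump_wait_le u0' neq; rewrite E lee_fin leNgt ur.
exists r; split => //; first exact/andP.
move=> eqr.
have [e e0 He] := step_path_right (Xstep w) (addr_ge0 s0 (ltW r0)).
have : ((r + e)%:E <= jump_wait X s w)%E.
  apply: jump_wait_ge => v /andP[v0 ve].
  have [vr|rv] := ltP v r; first by rewrite before ?v0.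
  by rewrite He// lerD2l rv -addrA ltrD2l.
by rewrite E lee_fin gerDl leNgt e0.
Qed.

(** The value after the first jump differs from [X s w], so it must be the final one. This turns the
    law of the first jump into a law for the increment over a cell. *)
Lemma one_jump_wait s h w : 0 <= s -> 0 < h ->
  (forall u, 0 <= u <= h -> X (s + u) w = X s w \/ X (s + u) w = X (s + h) w) ->
  X (s + h) w <> X s w ->
  (jump_wait X s w <= h%:E)%E /\
  jump_displacement X s w = X (s + h) w - X s w.
Proof.
move=> s0 h0 H neq; have wle := jump_wait_le h0 neq; split => //.
have [r [E /andP[r0 rh] neqr _]] := jump_waitP s0 wle.
rewrite /jump_displacement E/=.
by have [|//|->//] := H r; rewrite (ltW r0).
Qed.

Section measurability.
Hypothesis mX : forall t, 0 <= t -> measurable_fun setT (X t).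

(** On a grid fine enough for the path, the first jump lies in the first cell at whose end the value
    has changed, and the change seen there is its displacement. [C n] expresses this for the grid
    with [n.+1] cells. *)
Lemma measurable_first_jump s t (B : set 'rV[R]_d) : 0 <= s -> 0 <= t ->
  measurable B ->
  measurable [set w | (jump_wait X s w <= t%:E)%E /\ B (jump_displacement X s w)].
Proof.
move=> s0; rewrite le_eqVlt => /predU1P[<-|t0] mB.
  rewrite (_ : [set _ | _] = set0)// -subset0 => w [+ _].
  by rewrite leNgt jump_wait_gt0.
pose g n k := s + k%:R * (t / n.+1%:R).
have g0 n k : 0 <= g n k by rewrite addr_ge0// mulr_ge0// divr_ge0// ltW.
pose C n := \bigcup_(k in `I_n.+1)
  ((\bigcap_(j in `I_k.+1) [set w | X (g n j) w = X s w]) `&`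
   (~` [set w | X (g n k.+1) w = X s w] `&`
    (fun w => X (g n k.+1) w - X s w) @^-1` B)).
apply: (@measurable_eventually _ _ C).
  move=> n; apply: bigcup_measurable => k _.
  apply: measurableI.
    by apply: bigcap_measurableType => j _; apply: measurable_eq_rV; exact: mX.
  apply: measurableI.
    by apply: measurableC; apply: measurable_eq_rV; exact: mX.
  rewrite -[X in measurable X]setTI.
  by apply: measurable_sub => //; exact: mX.
move=> w; have [r r0 mesh] := step_path_mesh (Xstep w) (s + t) s0.
have cell : \forall n \near \oo, t / n.+1%:R <= r.
  near=> n; rewrite -ler_pdivlMl// ltW//.
  by near: n; apply: natSinv_lt; rewrite mulr_gt0 ?invr_gt0.
suff key n : t / n.+1%:R <= r ->
    ((jump_wait X s w <= t%:E)%E /\ B (jump_displacement X s w)) <-> C n w.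
  split => [A|A].
    by near=> n; apply/(key n) => //; near: n.
  have [n [Cn cn]] := @filter_ex _ _ _ _ (filterI A cell).
  exact/(key n).
move=> nr; pose c := t / n.+1%:R.
have c0 : 0 < c by rewrite divr_gt0.
have gS k : g n k.+1 = g n k + c by rewrite /g -natr1 mulrDl mul1r addrA.
have gt k : (k <= n.+1)%N -> g n k <= s + t.
  move=> kn; rewrite lerD2l (@le_trans _ _ (n.+1%:R * c))//.
    by rewrite ler_pM2r// ler_nat.
  by rewrite mulrC divfK.
have gle j k : (j <= k)%N -> g n j <= g n k.
  by move=> jk; rewrite lerD2l ler_pM2r// ler_nat.
have cellP k u : (k < n.+1)%N -> g n k <= u <= g n k.+1 ->
    X u w = X (g n k) w \/ X u w = X (g n k.+1) w.
  move=> kn /andP[gu ug]; apply: mesh => //; last by rewrite gS addrAC subrr add0r.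
    by rewrite lerDl mulr_ge0// ltW.
  exact: gt.
(* Equality at the grid points extends to all times between them, since inside a cell the path only
   takes the values at its ends. *)
have const k u : (k < n.+1)%N -> (forall j, (j <= k)%N -> X (g n j) w = X s w) ->
    s <= u <= g n k -> X u w = X s w.
  move=> kn H /andP[]; rewrite le_eqVlt => /predU1P[<-//|su] ug.
  have [i iN] := @grid_cell _ t (u - s) n ltac:(lra)
    ltac:(have := gt _ (ltnW kn); lra).
  rewrite -/c => /andP[iu ui].
  have ik : (i < k)%N.
    rewrite ltnNge; apply/negP => ki; have := gle _ _ ki; rewrite /g -/c in ug *.
    lra.
  have [|->|->] := @cellP i u iN; first by rewrite /g -/c; apply/andP; split; lra.
    exact: H (ltnW ik).
  exact: H.
split=> [[wt wB]|[k kn [Hk [neq HB]]]].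
  have [r' [E /andP[r'0 r't] neq before]] := jump_waitP s0 wt.
  have [k kn] := @grid_cell _ t r' n r'0 r't; rewrite -/c => /andP[kr rk].
  have Xr : X (s + r') w = X (g n k.+1) w.
    have [|Xk|//] := @cellP k (s + r') kn.
      by rewrite !lerD2l rk (ltW kr).
    exfalso; apply: neq; rewrite Xk before// kr mulr_ge0// ltW//.
  exists k => //; split.
    move=> j jk; apply: before; rewrite mulr_ge0 ?(ltW c0)//=.
    by apply: le_lt_trans kr; rewrite ler_pM2r// ler_nat.
  rewrite /= -Xr; split => //.
  by move: wB; rewrite /jump_displacement E.
have kc0 : 0 < k.+1%:R * c by rewrite mulr_gt0.
have wk := jump_wait_le kc0 neq.
have [r' [E /andP[r'0 r'k] neq' before]] := jump_waitP s0 wk.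
split.
  rewrite E lee_fin (le_trans r'k)//.
  by have := gt _ kn; rewrite /g lerD2l.
have kr : g n k <= s + r'.
  rewrite leNgt; apply/negP => rg; apply: neq'; apply: (const k) => //.
  by rewrite lerDl (ltW r'0) (ltW rg).
rewrite /jump_displacement E/=.
have [|Xk|->//] := @cellP k (s + r') kn; first by rewrite kr lerD2l.
by exfalso; apply: neq'; rewrite Xk; apply: (Hk k); rewrite /=.
Unshelve. all: by end_near. Qed.

End measurability.
End jumps.

(** * Mixtures of measures and histories *)

Section mixture.
Context dT dY (T : measurableType dT) (Y : measurableType dY) (R : realType).
Variables (m : {measure set T -> \bar R}) (A : set T).
Variable k : T -> {measure set Y -> \bar R}.
Local Open Scope ereal_scope.

(* The measurability proofs are arguments so that [mixture mA mk] can carry a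
   canonical measure structure. *)
Definition mixture (mA : measurable A)
    (mk : forall B, measurable B -> measurable_fun setT (fun w => k w B))
    (B : set Y) := \int[m]_(w in A) k w B.

Hypothesis mA : measurable A.
Hypothesis mk : forall B, measurable B -> measurable_fun setT (fun w => k w B).

Let mixture0 : mixture mA mk set0 = 0.
Proof. by apply: integral0_eq => w _; rewrite measure0. Qed.

Let mixture_ge0 B : 0 <= mixture mA mk B.
Proof. exact: integral_ge0. Qed.

Let mixture_sigma_additive : semi_sigma_additive (mixture mA mk).
Proof.
move=> F mF tF mUF; rewrite [X in _ --> X](_ : _ =
  \int[m]_(w in A) (\sum_(n <oo) k w (F n))); last first.
  apply: eq_integral => w _.
  by apply/esym/cvg_lim => //; exact/measure_semi_sigma_additive.
apply/cvg_closeP; split.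
  by apply: is_cvg_nneseries => n _ _; exact: integral_ge0.
rewrite closeE// integral_nneseries// => n.
by apply: measurable_funS (mk (mF n)).
Qed.

HB.instance Definition _ := isMeasure.Build _ _ R
  (mixture mA mk) mixture0 mixture_ge0 mixture_sigma_additive.

Import HBNNSimple.

Lemma ge0_integral_mixture (f : Y -> \bar R) :
  (forall y, 0 <= f y) -> measurable_fun setT f ->
  \int[mixture mA mk]_y f y = \int[m]_(w in A) \int[k w]_y f y.
Proof.
move=> f0 mf.
pose g := nnsfun_approx measurableT mf.
pose gE := fun n => EFin \o g n.
have mgE n : measurable_fun [set: Y] (gE n) by exact/measurable_EFinP.
have gE_ge0 n x : 0 <= gE n x by rewrite lee_fin.
have nd_gE x : {homo gE ^~ x : n m / (n <= m)%O >-> n <= m}.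
  by move=> *; exact/lefP/nd_nnsfun_approx.
have mint h : (forall y, 0 <= h y) -> measurable_fun setT h ->
    measurable_fun A (fun w => \int[k w]_y h y).
  move=> h0 mh; apply: measurable_funS (measurable_fun_integral_kernel _ h0 mh) => //.
have simple (h : {nnsfun Y >-> R}) :
    sintegral (mixture mA mk) h = \int[m]_(w in A) sintegral (k w) h.
  under eq_integral do rewrite sintegralE.
  rewrite ge0_integral_fsum//; last 2 first.
    by move=> r; apply: measurable_funeM; apply: measurable_funS (mk _).
    by move=> n x _; exact: nnsfun_mulemu_ge0.
  rewrite sintegralE /=; apply: eq_fsbigr => // r rh.
  have [r0|r0] := leP 0%R r.
    by rewrite ge0_integralZl//; apply: measurable_funS (mk _).
  rewrite preimage_nnfun0// measure0 mule0 integral0_eq// => w _.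
  by rewrite measure0 mule0.
transitivity (limn (fun n => \int[mixture mA mk]_x gE n x)).
  rewrite -monotone_convergence//; apply: eq_integral => t _.
  by apply/esym/cvg_lim => //; exact: cvg_nnsfun_approx.
transitivity (limn (fun n => \int[m]_(w in A) \int[k w]_x gE n x)).
  apply: congr_lim; apply/funext => n.
  rewrite integralT_nnsfun simple; apply: eq_integral => x _.
  by rewrite integralT_nnsfun.
rewrite -[LHS]monotone_convergence//; last 3 first.
  by move=> n; exact: mint.
  by move=> n x _; exact: integral_ge0.
  by move=> x _ i j ij; apply: ge0_le_integral => // t _; exact: nd_gE.
apply: eq_integral => t _.
rewrite -monotone_convergence//.
apply: eq_integral => y _.
by apply/cvg_lim => //; exact: cvg_nnsfun_approx.
Qed.

End mixture.

(** Passage from sets to nonnegative functions: both integrals are integrals of [g] against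
    mixtures, the left one being a mixture of Dirac masses at [D w], so a comparison of the two
    measures suffices. *)
Lemma ge0_integral_comp_le dT dY (T : measurableType dT) (Y : measurableType dY)
    (R : realType) (m : {measure set T -> \bar R}) (A C : set T)
    (k : T -> {measure set Y -> \bar R}) (D : T -> Y) (h : R) (g : Y -> \bar R) :
  measurable A -> measurable C ->
  (forall B, measurable B -> measurable_fun setT (fun w => k w B)) ->
  measurable_fun setT D -> 0 <= h ->
  (forall B, measurable B ->
    (m (C `&` D @^-1` B) <= h%:E * \int[m]_(w in A) k w B)%E) ->
  (forall y, (0 <= g y)%E) -> measurable_fun setT g ->
  (\int[m]_(w in C) g (D w) <= h%:E * \int[m]_(w in A) \int[k w]_y g y)%E.
Proof.
move=> mA mC mk mD h0 le g0 mg.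
pose kD w : {measure set Y -> \bar R} := \d_(D w).
have mkD B : measurable B -> measurable_fun setT (fun w => kD w B).
  move=> mB; rewrite /kD/= /dirac; apply/measurable_EFinP.
  by apply: measurableT_comp mD; exact: measurable_indic.
have -> : (\int[m]_(w in C) g (D w) = \int[mixture m mC mkD]_y g y)%E.
  rewrite ge0_integral_mixture//; apply: eq_integral => w _.
  by rewrite integral_dirac// diracT mul1e.
rewrite -(ge0_integral_mixture m mA mk g0 mg).
rewrite -(ge0_integral_mscale _ measurableT (NngNum h0))//.
apply: ge0_le_measure_integral => // B mB.
rewrite [X in (X <= _)%E](_ : _ = m (C `&` D @^-1` B)); first exact: le.
rewrite /= /mixture /kD/= /dirac.
under eq_integral do rewrite -[(\1_B (D _))]/(\1_(D @^-1` B) _).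
rewrite integral_indic// 1?setIC//.
by rewrite -[X in measurable X]setTI; exact: mD.
Qed.

Section history.
Context {R : realType} {d : nat} {disp : measure_display}
  {Omega : measurableType disp}.
Variable X : R -> Omega -> 'rV[R]_d.
Implicit Types (s t h u : R) (w : Omega).

(** The history as the sigma-algebra of a measurable type, so that general results on measurable
    functions apply to it. *)
Definition history_type s := g_sigma_algebraType
  (\bigcup_(u in `[0, s]) preimage_set_system setT (X u) measurable).

Lemma measurable_history_type s u : 0 <= u <= s ->
  measurable_fun setT (X u : history_type s -> 'rV[R]_d).
Proof.
move=> us _ B mB; apply: sub_sigma_algebra; exists u; first by rewrite /= in_itv.
by exists B.
Qed.

Lemma historyI s A B : history X s A -> history X s B -> history X s (A `&` B).
Proof. exact: (@measurableI _ (history_type s)). Qed.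

Lemma history_preimage s u B : 0 <= u <= s -> measurable B ->
  history X s (X u @^-1` B).
Proof.
by move=> us mB; rewrite -[X in history _ _ X]setTI; exact: measurable_history_type.
Qed.

Lemma history_le s t A : s <= t -> history X s A -> history X t A.
Proof.
move=> st; apply: sub_sigma_algebra2 => _ [u us [B mB <-]].
exists u; last by exists B.
by move: us; rewrite /= !in_itv/= => /andP[-> /le_trans]; exact.
Qed.

(** Weaker than having at most one jump, as the path may alternate between its two end values. It
    suffices: equal ends still mean no jump, and with distinct ends the first jump leads to the
    final value. *)
Definition one_jump s h : set Omega :=
  [set w | forall u, 0 <= u <= h -> X (s + u) w = X s w \/ X (s + u) w = X (s + h) w].

Hypothesis Xstep : forall w, step_path (X ^~ w).

Lemma history_one_jump s h : 0 <= s -> 0 < h -> history X (s + h) (one_jump s h).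
Proof.
move=> s0 h0.
rewrite (_ : one_jump s h = \bigcap_(q in [set q : rat | 0 <= q <= 1])
    ([set w | X (s + ratr q * h) w = X s w] `|`
     [set w | X (s + ratr q * h) w = X (s + h) w])).
  have ms u : 0 <= u <= h ->
      measurable_fun setT (X (s + u) : history_type (s + h) -> 'rV[R]_d).
    move=> /andP[u0 uh]; apply: measurable_history_type.
    by rewrite addr_ge0// lerD2l.
  apply: (@countable_bigcap_measurable _ (history_type (s + h))).
    exact: countableP.
  move=> q /andP[q0 q1].
  have mq := ms (ratr q * h); have m1 := ms h; have m0 := ms 0; rewrite addr0 in m0.
  have qh : 0 <= ratr q * h <= h.
    rewrite mulr_ge0 ?ler0q ?(ltW h0)//=.
    by rewrite ler_piMl ?(ltW h0)// -(rmorph1 (ratr : rat -> R)) ler_rat.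
  apply: (@measurableU _ (history_type (s + h))).
    by apply: measurable_eq_rV; [exact: mq|apply: m0; rewrite lexx ltW].
  by apply: measurable_eq_rV; [exact: mq|apply: m1; rewrite lexx ltW].
apply/seteqP; split=> w /=.
  by move/(one_jump_rat (Xstep w) s0 h0) => H q /H.
by move=> H; apply/(one_jump_rat (Xstep w) s0 h0) => q /H.
Qed.

Hypothesis mX : forall t, 0 <= t -> measurable_fun setT (X t).

Lemma history_measurable s A : history X s A -> measurable A.
Proof.
apply: smallest_sub; first exact: sigma_algebra_measurable.
move=> _ [u + [B mB <-]]; rewrite /= in_itv/= => /andP[u0 _].
exact: mX.
Qed.

End history.

(** * Bounds on the first jump *)

Section first_jump_bounds.
Context {R : realType} {d : nat} {disp : measure_display}
  {Omega : measurableType disp}.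
Variables (P : probability Omega R) (I : set 'rV[R]_d)
  (K : R.-ker 'rV[R]_d ~> 'rV[R]_d) (X : R -> Omega -> 'rV[R]_d).
Hypothesis XP : pure_jump_markov P I K X.
Local Open Scope ereal_scope.

Let Xstep := pjm_paths XP.
Let mX := pjm_measurable XP.

Lemma measurable_kernel_process s B : (0 <= s)%R -> measurable B ->
  measurable_fun setT (fun w => K (X s w) B).
Proof.
by move=> s0 mB; apply: measurableT_comp (measurable_kernel K B mB) (mX s0).
Qed.

Lemma measurable_jump_wait_le s t : (0 <= s)%R -> (0 <= t)%R ->
  measurable [set w | jump_wait X s w <= t%:E].
Proof.
move=> s0 t0.
rewrite (_ : [set _ | _] =
    [set w | (jump_wait X s w <= t%:E) /\ setT (jump_displacement X s w)]).
  exact: measurable_first_jump.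
by apply/seteqP; split=> w /=; [|case].
Qed.

Lemma first_jump_le s t A B : (0 <= s)%R -> (0 <= t)%R -> history X s A ->
  measurable B ->
  P (A `&` [set w | (jump_wait X s w <= t%:E) /\ B (jump_displacement X s w)])
    <= t%:E * \int[P]_(w in A) K (X s w) B.
Proof.
move=> s0 t0 hA mB; have mA := history_measurable mX hA.
rewrite (pjm_rates XP)//.
apply: (@le_trans _ _ (\int[lebesgue_measure]_(u in `[0%R, t])
    \int[P]_(w in A) K (X s w) B)).
  apply: ge0_le_integral_nomeas => u; rewrite /= in_itv/= => /andP[u0 ut].
    exact: integral_ge0.
  apply: ge0_subset_integral => //; last exact: measurable_funS (measurable_kernel_process _ _).
  apply: measurableI => //.
  rewrite (_ : [set _ | _] = ~` [set w | jump_wait X s w <= u%:E]).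
    by apply: measurableC; exact: measurable_jump_wait_le.
  by apply/seteqP; split=> w /=; rewrite ltNge => /negP.
rewrite integral_cst//= lebesgue_measure_itv/= lte_fin muleC.
case: ltP => [_|]; first by rewrite oppr0 adde0.
move=> t0'; rewrite (_ : t = 0%R) ?mul0e//; exact/le_anti/andP.
Qed.

Lemma one_jump_moved_le s h A B : (0 <= s)%R -> (0 < h)%R -> history X s A ->
  measurable B ->
  P (A `&` one_jump X s h `&` [set w | X (s + h)%R w <> X s w] `&`
     (fun w => X (s + h)%R w - X s w)%R @^-1` B)
    <= h%:E * \int[P]_(w in A) K (X s w) B.
Proof.
move=> s0 h0 hA mB; apply: le_trans (first_jump_le s0 (ltW h0) hA mB).
have mA := history_measurable mX hA.
have sh0 : (0 <= s + h)%R by rewrite addr_ge0// ltW.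
apply: le_measure; rewrite ?inE.
- apply: measurableI; last first.
    by rewrite -[X in measurable X]setTI; apply: measurable_sub => //; exact: mX.
  apply: measurableI; last first.
    by apply: measurableC; apply: measurable_eq_rV; exact: mX.
  by apply: measurableI => //; exact: history_measurable (history_one_jump _ _ _).
- by apply: measurableI => //; exact: measurable_first_jump (ltW h0) mB.
- move=> w [[[Aw Jw] neq] Bw]; split => //=.
  by have [wt ->] := one_jump_wait Xstep s0 h0 Jw neq.
Qed.

(** Paths that stay have not jumped by time [h], so a lower bound on the probability of a jump is
    needed. The rate formula gives [h] times the integrated rate, up to what is lost because paths
    that already jumped no longer contribute. *)
Lemma one_jump_stay_le s h A (L : R) : (0 <= s)%R -> (0 < h)%R ->
  history X s A -> (0 <= L)%R -> (forall w, A w -> K (X s w) setT <= L%:E) ->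
  P (A `&` one_jump X s h `&` [set w | X (s + h)%R w = X s w]) +
    h%:E * \int[P]_(w in A) K (X s w) setT
  <= (1 + (h * L) ^+ 2)%:E * P A.
Proof.
move=> s0 h0 hA L0 KL; have mA := history_measurable mX hA.
have sh0 : (0 <= s + h)%R by rewrite addr_ge0// ltW.
have mK := measurable_kernel_process s0 measurableT.
set c := \int[P]_(w in A) K (X s w) setT.
have intle (E : set Omega) : measurable E -> E `<=` A ->
    \int[P]_(w in E) K (X s w) setT <= L%:E * P E.
  move=> mE EA; rewrite -integral_cst//; apply: ge0_le_integral_nomeas => //.
  by move=> w /EA /KL.
have cL : c <= L%:E * P A by exact: intle.
have PAfin E : measurable E -> P E \is a fin_num by exact: fin_num_measure.
have cfin : c \is a fin_num.
  rewrite ge0_fin_numE ?integral_ge0//; apply: le_lt_trans cL _.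
  by rewrite ltey_eq fin_numM// PAfin.
pose Q u := [set w | jump_wait X s w <= u%:E].
have mQ u : (0 <= u)%R -> measurable (Q u) by move=> u0; exact: measurable_jump_wait_le.
have QE u : A `&` Q u =
    A `&` [set w | (jump_wait X s w <= u%:E) /\ setT (jump_displacement X s w)].
  by apply/seteqP; split=> w /= => [[? ?]|[? []]].
have PQ u : (0 <= u <= h)%R -> P (A `&` Q u) <= (h * L)%:E * P A.
  move=> /andP[u0 uh]; rewrite QE.
  apply: le_trans (first_jump_le s0 u0 hA measurableT) _.
  rewrite EFinM -muleA lee_pmul ?integral_ge0// ?lee_fin//.
(* A jump before time [u] has probability at most [h * L] times that of [A], and the rate lost on
   those paths is at most [L]. *)
have low u : (0 <= u <= h)%R ->
    c - (L * (h * L))%:E * P A <= \int[P]_(w in A `&` [set w | u%:E < jump_wait X s w]) K (X s w) setT.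
  move=> uh; have u0 : (0 <= u)%R by case/andP: uh.
  rewrite leeBlDr ?fin_numM ?PAfin//.
  have -> : c = \int[P]_(w in A `&` [set w | u%:E < jump_wait X s w]) K (X s w) setT +
               \int[P]_(w in A `&` Q u) K (X s w) setT.
    have nQ : [set w | u%:E < jump_wait X s w] = ~` Q u.
      by apply/seteqP; split=> w /=; rewrite ltNge => /negP.
    rewrite nQ -ge0_integral_setU//; last 4 first.
    - by apply: measurableI => //; exact/measurableC/mQ.
    - by apply: measurableI => //; exact: mQ.
    - exact: measurable_funS mK.
    - by apply/disj_setPS => w [[_ +] [_]].
    congr integral; rewrite -setIUr setUC setUv ?setIT//.
  rewrite leeD2l// (le_trans (intle _ _ _))//.
    by apply: measurableI => //; exact: mQ.
  rewrite EFinM -muleA lee_pmul ?lee_fin// PQ//.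
have PQh : h%:E * (c - (L * (h * L))%:E * P A) <= P (A `&` Q h).
  (* The comparison of integrals below needs a nonnegative lower bound; otherwise the claim is
     trivial. *)
  have [neg|pos] := leP (c - (L * (h * L))%:E * P A) 0.
    by apply: (@le_trans _ _ 0) => //; rewrite mule_ge0_le0// lee_fin ltW.
  rewrite QE (pjm_rates XP) ?(ltW h0)//.
  apply: (@le_trans _ _ (\int[lebesgue_measure]_(u in `[0%R, h]) (c - (L * (h * L))%:E * P A))).
    rewrite integral_cst//= lebesgue_measure_itv/= lte_fin h0.
    by rewrite oppr0 adde0 muleC.
  apply: ge0_le_integral_nomeas => u; rewrite /= in_itv/= => uh; first exact: ltW.
  exact: low.
have stay : P (A `&` one_jump X s h `&` [set w | X (s + h)%R w = X s w]) + P (A `&` Q h) <= P A.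
  rewrite -measureU//; last 3 first.
  - apply: measurableI; last by apply: measurable_eq_rV; exact: mX.
    by apply: measurableI => //; exact: history_measurable (history_one_jump _ _ _).
  - by apply: measurableI => //; exact/mQ/ltW.
  - rewrite -subset0 => w [[[Aw Jw] eq] [_ /(jump_waitP Xstep s0)]].
    move=> [r [_ /andP[r0 rh] neq _]].
    by apply: neq; have [|->|->] := Jw r; rewrite ?(ltW r0).
  apply: le_measure; rewrite ?inE//.
    apply: measurableU.
      apply: measurableI; last by apply: measurable_eq_rV; exact: mX.
      by apply: measurableI => //; exact: history_measurable (history_one_jump _ _ _).
    by apply: measurableI => //; exact/mQ/ltW.
  by move=> w [[[]]|[]].
have Q1 : P (A `&` Q h) \is a fin_num.
  by rewrite PAfin//; apply: measurableI => //; exact/mQ/ltW.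
have Q2 : P (A `&` one_jump X s h `&` [set w | X (s + h)%R w = X s w]) \is a fin_num.
  rewrite PAfin//.
  apply: measurableI; last by apply: measurable_eq_rV; exact: mX.
  by apply: measurableI => //; exact: history_measurable (history_one_jump _ _ _).
move: PQh stay; rewrite -(fineK cfin) -(fineK (PAfin _ mA)) -(fineK Q1) -(fineK Q2).
rewrite -!(EFinM, EFinN, EFinD) !lee_fin.
set p := fine _; set q := fine _; set r := fine _; set t := fine _.
lra.
Qed.

End first_jump_bounds.

(** * Exponential moments of the kernel *)

Section exponential_moments.
Context {R : realType} {d : nat} (hd : (0 < d)%N).
Variables (m : {measure set 'rV[R]_d -> \bar R}) (eta C n : R).
Hypotheses (eta0 : 0 < eta) (n0 : 0 < n).
Hypothesis mgf : forall theta : 'rV[R]_d, enorm theta <= eta ->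
  (\int[m]_y (expR (dotv (n *: theta) y))%:E <= (C * n)%:E)%E.

Lemma moment_mass : (m setT <= (C * n)%:E)%E.
Proof.
have := @mgf 0; rewrite enorm0 => /(_ (ltW eta0)).
under eq_integral do rewrite scaler0 -(scale0r 0) dotvZl mul0r expR0.
by rewrite integral_cst// mul1e.
Qed.

Let s := eta / d%:R.

Let s0 : 0 < s. Proof. by rewrite divr_gt0// ltr0n. Qed.

Let sn0 : 0 < s * n.
Proof. by apply: mulr_gt0. Qed.

Lemma enorm_le_dim_coord (y : 'rV[R]_d) : exists i, enorm y <= d%:R * `|y 0 i|.
Proof.
apply: contrapT => H.
have H' i : d%:R * `|y 0 i| < enorm y.
  by rewrite ltNge; apply/negP => yi; apply: H; exists i.
have : \sum_i d%:R * `|y 0 i| < \sum_(i < d) enorm y.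
  by apply: ltr_sum => //; apply/hasP; exists (Ordinal hd).
rewrite -mulr_sumr sumr_const card_ord -[enorm y *+ d]mulr_natl ltNge => /negP; apply.
by rewrite ler_pM2l ?ltr0n// enorm_le_sum.
Qed.

Lemma measurable_expR_enorm (c : R) :
  measurable_fun setT (fun y : 'rV[R]_d => (expR (c * enorm y))%:E).
Proof.
apply/measurable_EFinP; apply: measurableT_comp => //.
by apply: measurable_funM => //; exact: measurable_enorm.
Qed.

Lemma measurable_expR_coord (c : R) i :
  measurable_fun setT (fun y : 'rV[R]_d => (expR (c * y 0 i))%:E).
Proof.
apply/measurable_EFinP; apply: measurableT_comp => //.
by apply: measurable_funM => //; exact: measurable_coord.
Qed.

(** Some coordinate satisfies [enorm y <= d * |y_i|], hence the division by [d] in [s]: the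
    integrand is at most the sum of the [2 d] exponentials with parameters plus or minus [n * eta]
    along the axes, each of integral at most [C * n]. *)
Lemma moment_enorm :
  (\int[m]_y (expR (s * n * enorm y))%:E <= (2 * d%:R * C * n)%:E)%E.
Proof.
have coord c i : `|c| <= eta -> (\int[m]_y (expR (n * c * y 0 i))%:E <= (C * n)%:E)%E.
  move=> ce; have /mgf : enorm (c *: (delta_mx 0 i : 'rV[R]_d)) <= eta.
    rewrite enormZ /enorm /dotv (bigD1 i)//= big1 ?addr0.
      by rewrite mxE !eqxx mulr1 sqrtr1 mulr1.
    by move=> j ji; rewrite mxE (negbTE ji) andbF mul0r.
  under eq_integral => y _.
    rewrite !dotvZl /dotv (bigD1 i)//= big1 ?addr0; last first.
      by move=> j ji; rewrite mxE (negbTE ji) andbF mul0r.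
    by rewrite mxE !eqxx mul1r mulrA; over.
  by [].
have cN : `|- eta| <= eta by rewrite normrN gtr0_norm.
have cP : `|eta| <= eta by rewrite gtr0_norm.
apply: (@le_trans _ _ (\int[m]_y (\sum_(i < d) ((expR (n * eta * y 0 i))%:E
   + (expR (n * - eta * y 0 i))%:E)))%E).
  apply: ge0_le_integral_nomeas => y _; first by rewrite lee_fin expR_ge0.
  have [i yi] := enorm_le_dim_coord y.
  under eq_bigr do rewrite -EFinD.
  rewrite sumEFin lee_fin (bigD1 i)//= ler_wpDr//.
    by apply: sumr_ge0 => j _; rewrite addr_ge0 ?expR_ge0.
  have le1 : s * n * enorm y <= n * eta * `|y 0 i|.
    rewrite (_ : n * eta * _ = s * n * (d%:R * `|y 0 i|)).
      by rewrite ler_pM2l// mulr_gt0.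
    by rewrite /s; field; rewrite pnatr_eq0 -lt0n.
  have [y0|y0] := leP 0 (y 0 i).
    rewrite ler_wpDr ?expR_ge0// ler_expR; move: le1; rewrite ger0_norm//.
  rewrite ler_wpDl ?expR_ge0// ler_expR; move: le1; rewrite ltr0_norm//.
  by rewrite !mulrN !mulNr.
rewrite ge0_integral_sum//; last 2 first.
  by move=> i; apply: emeasurable_funD; apply: measurable_expR_coord.
  by move=> i y _; rewrite adde_ge0 ?lee_fin ?expR_ge0.
apply: (@le_trans _ _ (\sum_(i < d) ((C * n)%:E + (C * n)%:E))%E).
  apply: lee_sum => i _; rewrite ge0_integralD//; first by rewrite leeD ?coord.
    exact: measurable_expR_coord.
  exact: measurable_expR_coord.
under eq_bigr do rewrite -EFinD.
rewrite sumEFin lee_fin sumr_const card_ord -[_ *+ d]mulr_natl.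
by rewrite le_eqVlt; apply/orP; left; apply/eqP; ring.
Qed.

Let W (y : 'rV[R]_d) := expR (s * n * enorm y).

Let integrable_W : m.-integrable setT (EFin \o W).
Proof.
apply/integrableP; split; first exact: measurable_expR_enorm.
under eq_integral do rewrite /= ger0_norm ?expR_ge0//.
exact: le_lt_trans moment_enorm (ltry _).
Qed.

Let integrable_leW (f : 'rV[R]_d -> R) (c : R) : measurable_fun setT f ->
  (forall y, `|f y| <= c * W y) -> m.-integrable setT (EFin \o f).
Proof.
move=> mf fc; apply: (le_integrable measurableT _ _ (integrableZl measurableT c integrable_W)).
  exact/measurable_EFinP.
by move=> y _; rewrite /= lee_fin (le_trans (fc y))// ler_norm.
Qed.

Let W1 y : 1 <= W y.
Proof. by rewrite -expR0 ler_expR !mulr_ge0 ?enorm_ge0// ltW. Qed.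

Lemma integrable_moment1 (i : 'I_d) : m.-integrable setT (fun y => (y 0 i)%:E).
Proof.
apply: (@integrable_leW (fun y => y 0 i) (s * n)^-1); first exact: measurable_coord.
move=> y; rewrite ler_pdivlMl ?sn0//.
apply: le_trans (_ : s * n * enorm y <= _).
  by rewrite ler_pM2l ?sn0// enorm_coord.
by have := expR_ge1Dx (s * n * enorm y); rewrite /W; lra.
Qed.

Lemma integral_dotv (p : 'rV[R]_d) :
  (\int[m]_y (dotv p y)%:E =
   (dotv p (\row_i Rintegral m setT (fun y : 'rV[R]_d => y 0%R i)))%:E)%E.
Proof.
rewrite /dotv; under eq_integral do rewrite -sumEFin.
rewrite integral_sum//; last first.
  move=> i; have := integrableZl measurableT (p 0 i) (integrable_moment1 i).
  by under eq_fun do rewrite -EFinM.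
rewrite -sumEFin; apply: eq_bigr => i _.
under eq_integral do rewrite EFinM.
rewrite integralZl//; last exact: integrable_moment1.
rewrite mxE EFinM /Rintegral fineK//; apply: integrable_fin_num => //.
exact: integrable_moment1.
Qed.

(* The left-hand side minus [m setT] is the generator of the jump process
   applied to [expR (n * a * psi e)], relatively to that function. *)
Lemma moment_psi (a e : R) (u : 'rV[R]_d) : 0 <= a -> a <= s / 2 -> 0 < e ->
  (\int[m]_y (expR (n * a * (psi e (u + y) - psi e u)))%:E <=
   m setT + (n * a * (dotv u (\row_i Rintegral m setT (fun y : 'rV[R]_d => y 0%R i))
               / psi e u)
     + (a / (2 * e) / n + a ^+ 2) * (16 / s ^+ 2) * (2 * d%:R * C * n))%:E)%E.
Proof.
(* In [k], the term [a / (2 * e) / n] is the second order remainder of [psi] and [a ^+ 2] that of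
   the exponential; [16 / s ^+ 2] is the cost of bounding [(n |y|)^2], with or without its
   exponential factor, by [W y]. *)
move=> a0 as2 e0; set k := (a / (2 * e) / n + a ^+ 2) * (16 / s ^+ 2).
have pu := psi_gt0 u e0.
have k0 : 0 <= k.
  by rewrite mulr_ge0 ?divr_ge0 ?addr_ge0 ?sqr_ge0 ?divr_ge0// ?mulr_ge0// ltW.
(* The gradient of [n * a * psi e] at [u]. *)
pose p := (n * a / psi e u) *: u.
have pw y : expR (n * a * (psi e (u + y) - psi e u)) <= 1 + dotv p y + k * W y.
  apply: le_trans (expR_taylor _) _.
  set z := n * a * _.
  have na0 : 0 <= n * a by rewrite mulr_ge0// ltW.
  have zle : z <= dotv p y + a / (2 * e) / n * (n * enorm y) ^+ 2.
    rewrite (_ : _ + _ = n * a * (dotv u y / psi e u + enorm y ^+ 2 / (2 * e))).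
      by rewrite ler_wpM2l//; have := psi_taylor u y e0; lra.
    by rewrite /p dotvZl; field; rewrite ?gt_eqF//.
  have zabs : `|z| <= a * (n * enorm y).
    by rewrite normrM (ger0_norm na0) mulrCA mulrA ler_wpM2l// psi_dist.
  have r0 : 0 <= n * enorm y by rewrite mulr_ge0 ?enorm_ge0// ltW.
  have h1 : (n * enorm y) ^+ 2 * expR (a * (n * enorm y)) <= 16 / s ^+ 2 * W y.
    rewrite /W -(mulrA s); exact: sqr_expR_le.
  have h2 : z ^+ 2 * expR `|z| <= a ^+ 2 * (16 / s ^+ 2 * W y).
    apply: (@le_trans _ _ (a ^+ 2 * ((n * enorm y) ^+ 2 * expR (a * (n * enorm y))))).
      rewrite mulrA -exprMn ler_pM ?sqr_ge0 ?expR_ge0 ?ler_expR//.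
      rewrite -[z ^+ 2]real_normK ?num_real// ler_pXn2r// nnegrE.
      by rewrite mulr_ge0.
    by rewrite ler_wpM2l ?sqr_ge0.
  have h3 : a / (2 * e) / n * (n * enorm y) ^+ 2 <= a / (2 * e) / n * (16 / s ^+ 2 * W y).
    rewrite ler_wpM2l//; first by rewrite !divr_ge0// ?mulr_ge0// ltW.
    apply: le_trans h1; rewrite ler_peMr ?sqr_ge0//.
    by rewrite -expR0 ler_expR mulr_ge0.
  rewrite /k mulrDl mulrDl -!mulrA; rewrite -!mulrA in h2 h3 zle; lra.
have i1 : m.-integrable setT (EFin \o cst (1 : R)).
  by apply: (@integrable_leW (cst 1) 1) => // y; rewrite normr1 mul1r.
have i2 : m.-integrable setT (fun y => (dotv p y)%:E).
  rewrite (_ : (fun _ => _) = (fun y : 'rV[R]_d => \sum_(i < d) (p 0 i)%:E * (y 0%R i)%:E)%E).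
    by apply: integrable_sum => // i _; apply: integrableZl => //; exact: integrable_moment1.
  by apply/funext => y; rewrite /dotv -sumEFin.
have i3 : m.-integrable setT (fun y => k%:E * (W y)%:E)%E by exact: integrableZl.
have i12 : m.-integrable setT (fun y => 1%:E + (dotv p y)%:E)%E by exact: integrableD.
apply: (@le_trans _ _ (\int[m]_y ((1%:E + (dotv p y)%:E) + k%:E * (W y)%:E))%E).
  apply: ge0_le_integral_nomeas => y _; first by rewrite lee_fin expR_ge0.
  by rewrite -EFinM -!EFinD lee_fin.
rewrite integralD// integralD// integral_dotv integralZl//.
rewrite integral_cst// mul1e EFinD addeA leeD//.
  rewrite leeD2l// lee_fin /p dotvZl le_eqVlt; apply/orP; left; apply/eqP; ring.
rewrite [leRHS]EFinM; apply: lee_wpmul2l; first by rewrite lee_fin.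
exact: moment_enorm.
Qed.

End exponential_moments.

(** * Evolution over one cell of the grid *)

Section cell.
Context {R : realType} {d : nat} (hd : (0 < d)%N) {disp : measure_display}
  {Omega : measurableType disp}.
Variables (P : probability Omega R) (I S : set 'rV[R]_d)
  (K : R.-ker 'rV[R]_d ~> 'rV[R]_d) (X : R -> Omega -> 'rV[R]_d).
Hypothesis XP : pure_jump_markov P I K X.
Variables (eta C n L eps a e rem : R) (bt : 'rV[R]_d -> 'rV[R]_d).
Hypotheses (eta0 : 0 < eta) (C0 : 0 <= C) (n0 : 0 < n) (L0 : 0 <= L)
  (a0 : 0 <= a) (a_eta : a <= eta / d%:R / 2) (e0 : 0 < e).
Hypothesis mgf : forall x theta, (I `&` S) x -> enorm theta <= eta ->
  (\int[K x]_y (expR (dotv (n *: theta) y))%:E <= (C * n)%:E)%E.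
Hypothesis drift_bt : forall x, (I `&` S) x -> enorm (drift K x - bt x) <= eps.
Hypothesis bt_lip : forall x y, enorm (bt x - bt y) <= L * enorm (x - y).
Hypothesis rem_ge : (a / (2 * e) / n + a ^+ 2) * (16 / (eta / d%:R) ^+ 2) *
  (2 * d%:R * C * n) <= rem.

Variables (t h : R) (p q : 'rV[R]_d) (del : R).
Hypotheses (t0 : 0 <= t) (h0 : 0 < h).
Hypothesis pq : enorm (q - p - h *: bt p) <= del.

Let Xstep := pjm_paths XP.
Let mX := pjm_measurable XP.
Let J := one_jump X t h.
Let th0 : 0 <= t + h. Proof. by rewrite addr_ge0// ltW. Qed.

Let mJ : measurable J.
Proof. exact: (history_measurable mX (history_one_jump Xstep t0 h0)). Qed.

Let weight (r : R) (f : 'rV[R]_d) := expR (n * r * psi e f).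

Let measurable_weight r s (z : 'rV[R]_d) D : 0 <= s ->
  measurable_fun D (fun w => (weight r (X s w - z))%:E).
Proof.
move=> s0; rewrite /weight; apply/measurable_EFinP; apply: measurable_funTS.
apply: measurableT_comp => //; apply: measurable_funM => //.
by apply: measurable_psi; apply: measurable_sub => //; exact: mX.
Qed.

(** The four errors over a cell: Euler error of the limiting path, error on the drift, second order
    terms of the generator, and the quadratic error on the probability of staying. Here [p] and [q]
    stand for the limiting path at the two ends of the cell. *)
Let kap := n * a * del + h * (n * a * eps) + h * rem + (h * (C * n)) ^+ 2.

(** With [X t] replaced by [c], the weight becomes a function of the displacement only. The total
    masses of the kernel in the bounds for moving and for staying then cancel, leaving the generator
    term [h * beta]. The Lipschitz growth of the drift away from [p] produces the factor
    [1 + h * L]. *)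
Lemma cell_local (A : set Omega) (c : 'rV[R]_d) (rho : R) :
  history X t A -> A `<=` X t @^-1` S -> 0 <= rho ->
  (forall w, A w -> enorm (X t w - c) <= rho) ->
  (\int[P]_(w in A `&` J) (weight a (X (t + h) w - q))%:E <=
   (expR (kap + rho * (n * a + h * (n * a * L)))
      * weight (a * (1 + h * L)) (c - p))%:E * P A)%E.
Proof.
move=> hA AS rho0 Ac; have mA := history_measurable mX hA.
have na0 : 0 <= n * a by rewrite mulr_ge0// ltW.
have mAJ : measurable (A `&` J) by exact: measurableI.
pose u := c - q; have pu := psi_gt0 u e0.
pose g y := expR (n * a * (psi e (u + y) - psi e u)).
have mg : measurable_fun setT (fun y => (g y)%:E).
  apply/measurable_EFinP; apply: measurableT_comp => //.
  apply: measurable_funM => //; apply: measurable_funB => //.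
  by apply: measurable_psi; exact: measurable_add.
pose D w := X (t + h) w - X t w.
have mD : measurable_fun setT D by apply: measurable_sub; exact: mX.
have mgD E : measurable_fun E (fun w => (g (D w))%:E).
  by apply: measurable_funTS; exact: measurableT_comp mg mD.
have gD0 w : (0 <= (g (D w))%:E)%E by rewrite lee_fin expR_ge0.
pose M := expR (n * a * (rho + psi e u)).
have M0 : (0 <= M%:E)%E by rewrite lee_fin expR_ge0.
have le1 : (\int[P]_(w in A `&` J) (weight a (X (t + h) w - q))%:E <=
    M%:E * \int[P]_(w in A `&` J) (g (D w))%:E)%E.
  rewrite -ge0_integralZl//.
  apply: ge0_le_integral_nomeas => w [Aw Jw]; first by rewrite lee_fin expR_ge0.
  rewrite -EFinM lee_fin -expRD ler_expR -mulrDr ler_wpM2l//.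
  rewrite (_ : X (t + h) w - q = u + D w + (X t w - c)); last first.
    by rewrite /u /D; apply/rowP => i; rewrite !mxE; ring.
  apply: le_trans (psi_lipschitz _ _ e0) _.
  by have := Ac w Aw; lra.
pose eqs := [set w | X (t + h) w = X t w].
have meqs : measurable eqs by apply: measurable_eq_rV; exact: mX.
have mAJe : measurable (A `&` J `&` eqs) by exact: measurableI.
have mAJn : measurable (A `&` J `&` ~` eqs).
  by apply: measurableI => //; exact: measurableC.
have split1 : (\int[P]_(w in A `&` J) (g (D w))%:E =
    P (A `&` J `&` eqs) + \int[P]_(w in A `&` J `&` ~` eqs) (g (D w))%:E)%E.
  rewrite -[in LHS](setIT (A `&` J)) -(setUv eqs) setIUr ge0_integral_setU//; last first.
    by apply/disj_setPS => w [[_ +] [_]].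
  congr (_ + _)%E; rewrite -[RHS]mul1e -integral_cst//.
  apply: eq_integral => w; rewrite inE => -[_ eq].
  by rewrite /g /D eq subrr addr0 subrr mulr0 expR0.
have mK B : measurable B -> measurable_fun setT (fun w => K (X t w) B).
  by move=> mB; exact: (measurable_kernel_process XP t0 mB).
have le2 : (\int[P]_(w in A `&` J `&` ~` eqs) (g (D w))%:E <=
    h%:E * \int[P]_(w in A) \int[K (X t w)]_y (g y)%:E)%E.
  apply: (@ge0_integral_comp_le _ _ _ _ _ P A _ (fun w => K (X t w)) D h (EFin \o g)) => //.
  - exact: ltW.
  - by move=> B mB; exact: (one_jump_moved_le XP t0 h0 hA mB).
  - by move=> y; rewrite lee_fin expR_ge0.
have KL w : A w -> (K (X t w) setT <= (C * n)%:E)%E.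
  move=> Aw; apply: (moment_mass eta0) => theta th; apply: mgf => //.
  by split; [exact: (pjm_values XP)|exact: AS].
pose w0 := dotv u (bt p) / psi e u + (eps + (L * rho + L * psi e (c - p))).
pose beta := n * a * w0 + rem.
have le3 w : A w -> (\int[K (X t w)]_y (g y)%:E <= K (X t w) setT + beta%:E)%E.
  move=> Aw; have IS : (I `&` S) (X t w) by split; [exact: (pjm_values XP)|exact: AS].
  have := moment_psi hd eta0 n0 (fun theta => @mgf (X t w) theta IS) u a0 a_eta e0.
  move/le_trans; apply; rewrite leeD2l// lee_fin lerD// ler_wpM2l// /w0.
  set b := (\row_i _).
  (* Only [bt p] is kept exactly, to be compensated by the motion from [p] to [q]; the other
     differences cost [eps], [L * rho] and [L * psi e (c - p)]. *)
  have -> : b = bt p + (b - bt (X t w) + (bt (X t w) - bt c + (bt c - bt p))).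
    by apply/rowP => i; rewrite !mxE; ring.
  rewrite dotvDr mulrDl lerD2l; apply: le_trans (dotv_psi_le _ _ e0) _.
  apply: le_trans (ler_enormD _ _) _; rewrite lerD//; first exact: drift_bt.
  apply: le_trans (ler_enormD _ _) _; rewrite lerD//.
    by apply: le_trans (bt_lip _ _) _; rewrite ler_wpM2l// Ac.
  by apply: le_trans (bt_lip _ _) _; rewrite ler_wpM2l// enorm_le_psi.
have CL0 : 0 <= C * n by rewrite mulr_ge0// ltW.
have le4 := one_jump_stay_le XP t0 h0 hA CL0 KL.
have PAfin : P A \is a fin_num by exact: fin_num_measure.
have intK : (\int[P]_(w in A) K (X t w) setT)%E \is a fin_num.
  rewrite ge0_fin_numE ?integral_ge0//.
  apply: (@le_lt_trans _ _ ((C * n)%:E * P A)%E); last first.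
    by rewrite ltey_eq fin_numM.
  by rewrite -integral_cst//; apply: ge0_le_integral_nomeas.
have le5 : (\int[P]_(w in A) \int[K (X t w)]_y (g y)%:E <=
    \int[P]_(w in A) K (X t w) setT + beta%:E * P A)%E.
  (* [beta] may be negative, while additivity is used for integrals of nonnegative functions; its
     negative part is moved to the left. *)
  pose b1 := Num.max (- beta) 0; pose b2 := Num.max beta 0.
  have b12 : beta = b2 - b1.
    rewrite /b1 /b2; have [b0|/ltW b0] := leP beta 0.
      by rewrite max_l ?oppr_ge0// opprK add0r.
    by rewrite max_r ?oppr_le0// subr0.
  have b10 : 0 <= b1 by rewrite le_max lexx orbT.
  have b20 : 0 <= b2 by rewrite le_max lexx orbT.
  have : (\int[P]_(w in A) \int[K (X t w)]_y (g y)%:E + b1%:E * P A <=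
      \int[P]_(w in A) K (X t w) setT + b2%:E * P A)%E.
    have mKA : measurable_fun A (fun w => K (X t w) setT).
      by apply: measurable_funTS; exact: mK.
    have mIA : measurable_fun A (fun w => \int[K (X t w)]_y (g y)%:E)%E.
      apply: measurable_funTS; apply: measurable_fun_integral_kernel => // y.
      by rewrite lee_fin expR_ge0.
    have I0 w : (0 <= \int[K (X t w)]_y (g y)%:E)%E.
      by apply: integral_ge0 => y _; rewrite lee_fin expR_ge0.
    rewrite -!integral_cst// -!ge0_integralD//.
    apply: ge0_le_integral_nomeas => w Aw.
      by rewrite adde_ge0// integral_ge0// => y _; rewrite lee_fin expR_ge0.
    apply: le_trans (leeD2r _ (le3 w Aw)) _.
    by rewrite -addeA -EFinD b12 subrK.
  rewrite -leeBrDr ?fin_numM// => /le_trans; apply.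
  by rewrite -(fineK PAfin) -(fineK intK) -!(EFinM, EFinN, EFinD) lee_fin b12; lra.
have intg0 : (0 <= \int[P]_(w in A) \int[K (X t w)]_y (g y)%:E)%E.
  by apply: integral_ge0 => w _; apply: integral_ge0 => y _; rewrite lee_fin expR_ge0.
have le6 : (\int[P]_(w in A `&` J) (g (D w))%:E <=
    (expR ((h * (C * n)) ^+ 2 + h * beta))%:E * P A)%E.
  rewrite split1; apply: (@le_trans _ _ ((1 + (h * (C * n)) ^+ 2 + h * beta)%:E * P A)%E).
    have := le_trans le2 (lee_wpmul2l (_ : (0 <= h%:E)%E) le5).
    rewrite lee_fin ltW// => /(_ isT) le7.
    apply: le_trans (leeD2l _ le7) _.
    have Pfin : P (A `&` J `&` eqs) \is a fin_num.
      by apply: fin_num_measure; apply: measurableI => //; exact: measurableI.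
    move: le4; rewrite -/J -/eqs -(fineK PAfin) -(fineK intK) -(fineK Pfin).
    rewrite -!(EFinM, EFinN, EFinD) !lee_fin; lra.
  rewrite lee_wpmul2r// lee_fin -addrA; exact: expR_ge1Dx.
apply: le_trans le1 _.
apply: (@le_trans _ _ (M%:E * ((expR ((h * (C * n)) ^+ 2 + h * beta))%:E * P A))%E).
  by rewrite lee_wpmul2l// lee_fin expR_ge0.
rewrite muleA -EFinM lee_wpmul2r// lee_fin /M /weight -!expRD ler_expR.
(* The gradient is taken at the end point [u = c - q], so convexity brings [psi] back to [c - p]
   with the right sign and no remainder. *)
have conv := psi_convex u (q - p) e0.
have uqp : u + (q - p) = c - p by rewrite /u; apply/rowP => i; rewrite !mxE; ring.
rewrite uqp in conv.
have hb : h * (dotv u (bt p) / psi e u) <= dotv u (q - p) / psi e u + del.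
  rewrite mulrA -dotvZr -lerBlDl -mulrBl -dotvBr.
  apply: le_trans (dotv_psi_le _ _ e0) _.
  by rewrite -enormN opprB; exact: pq.
have key : psi e u + h * (dotv u (bt p) / psi e u) <= psi e (c - p) + del by lra.
have := ler_wpM2l na0 key.
rewrite /kap /beta /w0; lra.
Qed.

(** [A] is cut into disjoint history events on which [X t] lies within [rho] of a rational point;
    summing the local bounds costs a multiple of [rho], which fits in the gap between [kap] and
    [kappa]. *)
Lemma cell_estimate (A : set Omega) (kappa : R) :
  history X t A -> A `<=` X t @^-1` S -> kap < kappa ->
  (\int[P]_(w in A `&` J) (weight a (X (t + h) w - q))%:E <=
   (expR kappa)%:E * \int[P]_(w in A) (weight (a * (1 + h * L)) (X t w - p))%:E)%E.
Proof.
move=> hA AS kk; have mA := history_measurable mX hA.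
have na0 : 0 <= n * a by rewrite mulr_ge0// ltW.
have hL0 : 0 <= h * L by rewrite mulr_ge0// ltW.
(* The first two terms are the loss in [cell_local], the third comes from returning from the centre
   to [X t]; adding 1 ensures positivity. *)
pose c1 := n * a + h * (n * a * L) + n * (a * (1 + h * L)) + 1.
have c10 : 0 < c1.
  by rewrite ltr_wpDl// !addr_ge0// ?mulr_ge0// ?addr_ge0// ?mulr_ge0// ltW.
pose rho := (kappa - kap) / c1.
have rho0 : 0 < rho by rewrite divr_gt0// subr_gt0.
have rc1 : rho * c1 = kappa - kap by rewrite divfK// gt_eqF.
(* An enumeration of the rational points; integers that code no point give 0, which is harmless as
   only density matters. *)
pose c i : 'rV[R]_d := ratrV (odflt 0 (unpickle i : option 'rV[rat]_d)).
have cdense x : exists i, enorm (x - c i) <= rho.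
  have [q' Hq] := @ratrV_dense R d x (rho / d%:R) ltac:(by rewrite divr_gt0// ltr0n).
  exists (pickle q'); rewrite /c pickleK/=.
  apply: le_trans (enorm_le_sum _) _.
  apply: le_trans (_ : \sum_(i < d) rho / d%:R <= _).
    by apply: ler_sum => i _; rewrite !mxE ltW//; have := Hq i; rewrite !mxE.
  by rewrite sumr_const card_ord -[_ *+ _]mulr_natr divfK// pnatr_eq0 -lt0n.
pose F i := A `&` X t @^-1` [set x | enorm (x - c i) <= rho].
have hF i : history X t (F i).
  apply: historyI => //; apply: history_preimage; first by rewrite t0 lexx.
  by apply: measurable_le_set => //; apply: measurable_enorm; exact: measurable_sub.
pose G := seqDU F.
have hG i : history X t (G i) by exact: (@seqDU_measurable _ (history_type X t) F hF).
have mG i : measurable (G i) := history_measurable mX (hG i).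
have GF i : G i `<=` F i by exact: subset_seqDU.
have AG : A = \bigcup_i G i.
  rewrite -seqDU_bigcup_eq; apply/seteqP; split => [w Aw|w [i _ []//]].
  by have [i Hi] := cdense (X t w); exists i.
have tG : trivIset setT G by exact: trivIset_seqDU.
have w0 r x : (0 <= (weight r x)%:E)%E by rewrite lee_fin expR_ge0.
rewrite {1}AG setI_bigcupl ge0_integral_bigcup//; last 3 first.
- by move=> i; exact: measurableI.
- exact: measurable_weight.
- exact: trivIset_setIr.
rewrite [X in (_ <= _ * \int[_]_(_ in X) _)%E]AG ge0_integral_bigcup//; last first.
  exact: measurable_weight.
rewrite -nneseriesZl; last by move=> i _; exact: integral_ge0.
apply: lee_nneseries => i; first by move=> _ _; exact: integral_ge0.
move=> _; have GS : G i `<=` X t @^-1` S by move=> w /GF[/AS].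
have := cell_local (hG i) GS (ltW rho0) (fun w Gw => (GF i w Gw).2).
move/le_trans; apply.
have mw : measurable_fun (G i) (fun w => (weight (a * (1 + h * L)) (X t w - p))%:E).
  exact: measurable_weight.
have k0 : (0 <= (expR kappa)%:E)%E by rewrite lee_fin expR_ge0.
rewrite -(integral_cst P (mG i)).
rewrite -(ge0_integralZl P (mG i) mw (fun w _ => w0 _ _) k0).
apply: ge0_le_integral_nomeas => w Gw; first by rewrite lee_fin mulr_ge0// expR_ge0.
rewrite /cst -EFinM lee_fin /weight -!expRD ler_expR.
have cp : psi e (c i - p) <= psi e (X t w - p) + rho.
  rewrite (_ : c i - p = X t w - p + (c i - X t w)); last first.
    by apply/rowP => j; rewrite !mxE; ring.
  apply: le_trans (psi_lipschitz _ _ e0) _.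
  by rewrite lerD2l enormB; exact: (GF i w Gw).2.
have nb0 : 0 <= n * (a * (1 + h * L)) by rewrite !mulr_ge0// ?addr_ge0// ltW.
have := ler_wpM2l nb0 cp; move: rc1; rewrite /c1; lra.
Qed.

End cell.

(** * The limiting differential equation *)

Section ode.
Context {R : realType} {d : nat}.
Variables (bt : 'rV[R]_d -> 'rV[R]_d) (L : R) (p0 : 'rV[R]_d) (x : R -> 'rV[R]_d).
Hypotheses (L0 : 0 <= L)
  (bt_lip : forall u v, enorm (bt u - bt v) <= L * enorm (u - v))
  (sol : ode_solution bt p0 x).

Lemma ode_coord_derive (t : R) i : 0 < t ->
  is_derive t 1 (fun s => x s 0 i) (bt (x t) 0 i).
Proof.
move=> t0; have [_ _ /(_ t t0) [dx dxE]] := sol.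
have cv : (fun h => h^-1 *: (((fun s => x s 0 i) \o shift t) (h *: (1:R)) - x t 0 i))
    @ 0^' --> bt (x t) 0 i.
  rewrite (_ : (fun h => _) = (fun u : 'rV[R]_d => u 0 i) \o
      (fun h => h^-1 *: ((x \o shift t) (h *: (1:R)) - x t))); last first.
    by apply/funext => h /=; rewrite !mxE.
  rewrite -dxE; apply: (@cvg_comp _ _ _ _ (fun u : 'rV[R]_d => u 0 i) _ _ _ dx).
  exact: coord_continuous.
by apply: DeriveDef; [exact: cvgP cv|exact: cvg_lim].
Qed.

Lemma ode_coord_continuous (s u : R) i : 0 <= s -> s < u ->
  {within `[s, u], continuous (fun t => x t 0 i)}.
Proof.
move=> s0 su.
have cont t : 0 < t -> {for t, continuous (fun t => x t 0 i)}.
  move=> t0; have [dt _] := ode_coord_derive i t0.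
  by apply: differentiable_continuous; apply/derivable1_diffP.
apply/continuous_within_itvP => //; split.
- by move=> t; rewrite in_itv/= => /andP[st _]; apply: cont; exact: le_lt_trans st.
- have [s0'|s0'] := ltP 0 s; first exact/cvg_at_right_filter/cont.
  have -> : s = 0 by exact/le_anti/andP.
  have [_ + _] := sol; move=> der.
  (* At time 0 only the right derivative is available; multiplying the difference quotient by [h]
     yields right-continuity. *)
  have der1 : h *: (h^-1 *: (x h - x 0)) @[h --> 0^'+] --> (0 : R) *: bt (x 0).
    by apply: cvgZ => //; apply: cvg_at_right_filter; exact: cvg_id.
  have der2 : x h - x 0 @[h --> 0^'+] --> (0 : 'rV[R]_d).
    rewrite scale0r in der1; apply: cvg_trans der1; apply: near_eq_cvg.
    near=> h; have h0 : 0 < h by near: h; exact: nbhs_right_gt.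
    by rewrite scalerA divff ?gt_eqF// scale1r.
  have der3 : x h - x 0 + x 0 @[h --> 0^'+] --> x 0.
    by rewrite -[X in _ --> X]add0r; apply: cvgD => //; exact: cvg_cst.
  have der4 : x h @[h --> 0^'+] --> x 0.
    by move: der3; under eq_fun do rewrite subrK.
  apply: (@cvg_comp _ _ _ _ (fun u : 'rV[R]_d => u 0 i) _ _ _ der4).
  exact: coord_continuous.
- by apply/cvg_at_left_filter/cont; exact: le_lt_trans su.
Unshelve. all: by end_near. Qed.

Lemma ode_coord_mvt (s u : R) i : 0 <= s -> s <= u ->
  exists2 c, s <= c <= u & x u 0 i - x s 0 i = bt (x c) 0 i * (u - s).
Proof.
move=> s0; rewrite le_eqVlt => /predU1P[<-|su].
  by exists s; rewrite ?lexx// !subrr mulr0.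
have [|c + eqc] := MVT su _ (@ode_coord_continuous s u i s0 su) (df := fun c => bt (x c) 0 i).
  move=> t; rewrite in_itv/= => /andP[st _]; apply: ode_coord_derive.
  exact: le_lt_trans st.
by rewrite in_itv/= => /andP[sc cu]; exists c; rewrite ?(ltW sc)// ltW.
Qed.

Lemma ode_drift_bounded (T : R) : 0 < T ->
  exists2 B, 0 <= B & forall t, 0 <= t <= T -> enorm (bt (x t)) <= B.
Proof.
move=> T0.
have H i : exists c, forall t, 0 <= t <= T -> `|x t 0 i| <= c.
  have cont := @ode_coord_continuous 0 T i (lexx 0) T0.
  have [c1 _ H1] := EVT_max (ltW T0) cont; have [c2 _ H2] := EVT_min (ltW T0) cont.
  exists (`|x c1 0 i| + `|x c2 0 i|) => t tT.
  have /H1 h1 : t \in `[0, T] by rewrite in_itv.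
  have /H2 h2 : t \in `[0, T] by rewrite in_itv.
  have := ler_norm (x c1 0 i); have := ler_norm (- x c2 0 i); rewrite normrN.
  have := normr_ge0 (x c1 0 i); have := normr_ge0 (x c2 0 i).
  by move=> *; rewrite ler_norml; apply/andP; split; lra.
pose c i := projT1 (cid (H i)).
have Hc i t : 0 <= t <= T -> `|x t 0 i| <= c i by exact: (projT2 (cid (H i))).
exists (enorm (bt 0) + L * \sum_i `|c i|).
  by rewrite addr_ge0 ?enorm_ge0// mulr_ge0// sumr_ge0.
move=> t tT; apply: le_trans (ler_enormB _ (bt 0)) _; rewrite lerD2l.
apply: le_trans (bt_lip _ _) _; rewrite subr0 ler_wpM2l//.
apply: le_trans (enorm_le_sum _) _; apply: ler_sum => i _.
by apply: le_trans (Hc i t tT) _; exact: ler_norm.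
Qed.

(** The mean value theorem is applied to each coordinate, at a time depending on the coordinate, and
    summing costs a factor [d]. The second bound combines it with the first one through the
    Lipschitz property of [bt]; [M] is the sum of the two constants. *)
Lemma ode_increment (T : R) : 0 < T -> exists2 M, 0 <= M &
  (forall s u, 0 <= s -> s <= u -> u <= T -> enorm (x u - x s) <= M * (u - s)) /\
  (forall s h, 0 <= s -> 0 <= h -> s + h <= T ->
     enorm (x (s + h) - x s - h *: bt (x s)) <= M * h ^+ 2).
Proof.
move=> T0; have [B B0 HB] := ode_drift_bounded T0.
have sumc (c : R) : \sum_(i < d) c = d%:R * c.
  by rewrite sumr_const card_ord -[_ *+ _]mulr_natl.
have inc s u : 0 <= s -> s <= u -> u <= T -> enorm (x u - x s) <= d%:R * B * (u - s).
  move=> s0 su uT; apply: le_trans (enorm_le_sum _) _.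
  rewrite -mulrA -sumc; apply: ler_sum => i _; rewrite !mxE.
  have [c /andP[sc cu] ->] := ode_coord_mvt i s0 su.
  rewrite normrM [`|u - s|]ger0_norm ?subr_ge0// ler_wpM2r ?subr_ge0//.
  apply: le_trans (enorm_coord _ _) _; apply: HB.
  by rewrite (le_trans s0 sc) (le_trans cu).
have dB0 : 0 <= d%:R * B by rewrite mulr_ge0.
exists (d%:R * B + d%:R * (L * (d%:R * B))).
  by rewrite addr_ge0// mulr_ge0// mulr_ge0.
split=> [s u s0 su uT|s h s0 h0 shT].
  apply: le_trans (inc s u s0 su uT) _; rewrite ler_wpM2r ?subr_ge0//.
  by rewrite lerDl mulr_ge0// mulr_ge0.
apply: (@le_trans _ _ (d%:R * (L * (d%:R * B)) * h ^+ 2)); last first.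
  by rewrite ler_wpM2r ?sqr_ge0// lerDr.
apply: le_trans (enorm_le_sum _) _.
rewrite -mulrA -sumc; apply: ler_sum => i _.
have sh : s <= s + h by rewrite lerDl.
have [c /andP[sc cu] eqc] := ode_coord_mvt i s0 sh.
rewrite (_ : _ 0 i = (bt (x c) - bt (x s)) 0 i * h); last first.
  by move: eqc; rewrite !mxE => ->; ring.
rewrite normrM (ger0_norm h0) expr2 mulrA ler_wpM2r//.
apply: le_trans (enorm_coord _ _) _; apply: le_trans (bt_lip _ _) _.
rewrite -mulrA ler_wpM2l//.
apply: le_trans (inc s c s0 sc (le_trans cu shT)) _.
by rewrite ler_wpM2l//; move: cu; lra.
Qed.

End ode.

(** * Evolution along the grid *)

Section grid.
Context {R : realType} {d : nat} (hd : (0 < d)%N) {disp : measure_display}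
  {Omega : measurableType disp}.
Variables (P : probability Omega R) (I S : set 'rV[R]_d)
  (K : R.-ker 'rV[R]_d ~> 'rV[R]_d) (X : R -> Omega -> 'rV[R]_d).
Hypothesis XP : pure_jump_markov P I K X.
Variables (eta C n L eps a e rem : R) (bt : 'rV[R]_d -> 'rV[R]_d).
Hypotheses (eta0 : 0 < eta) (C0 : 0 <= C) (n0 : 0 < n) (L0 : 0 <= L)
  (a0 : 0 <= a) (a_eta : a <= eta / d%:R / 2) (e0 : 0 < e) (eps0 : 0 <= eps).
Hypothesis mgf : forall x theta, (I `&` S) x -> enorm theta <= eta ->
  (\int[K x]_y (expR (dotv (n *: theta) y))%:E <= (C * n)%:E)%E.
Hypothesis drift_bt : forall x, (I `&` S) x -> enorm (drift K x - bt x) <= eps.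
Hypothesis bt_lip : forall x y, enorm (bt x - bt y) <= L * enorm (x - y).
Hypothesis rem_ge : (a / (2 * e) / n + a ^+ 2) * (16 / (eta / d%:R) ^+ 2) *
  (2 * d%:R * C * n) <= rem.
Hypothesis mS : measurable S.
Variables (x : R -> 'rV[R]_d) (T M del0 del1 : R).
Hypotheses (T0 : 0 < T) (M0 : 0 <= M).
Hypothesis x_euler : forall s h, 0 <= s -> 0 <= h -> s + h <= T ->
  enorm (x (s + h) - x s - h *: bt (x s)) <= M * h ^+ 2.

Let Xstep := pjm_paths XP.
Let mX := pjm_measurable XP.

Variable m : nat.
Let h := T / m.+1%:R.
Hypothesis h_small : h * (n * a * M + (C * n) ^+ 2) < 1.

Let h0 : 0 < h. Proof. by rewrite divr_gt0. Qed.

Definition gridpt (k : nat) : R := k%:R * (T / m.+1%:R).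

Lemma gridptS k : gridpt k.+1 = gridpt k + h.
Proof. by rewrite /gridpt -natr1 mulrDl mul1r. Qed.

Lemma gridpt_ge0 k : 0 <= gridpt k.
Proof. by rewrite mulr_ge0// ltW. Qed.

Lemma gridpt_le k : (k <= m.+1)%N -> gridpt k <= T.
Proof.
move=> km; apply: (@le_trans _ _ (m.+1%:R * h)).
  by rewrite ler_pM2r// ler_nat.
by rewrite mulrC divfK.
Qed.

Fixpoint good (k : nat) : set Omega :=
  if k is j.+1 then
    good j `&` one_jump X (gridpt j) h `&`
      X (gridpt j + h) @^-1` (S `&` [set y | enorm (y - x (gridpt j + h)) <= del1])
  else X 0 @^-1` (S `&` [set y | enorm (y - x 0) <= del0]).

(** First exceedance of [del1] after time 0, at the end of cell [k]. Membership in [S] is required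
    only up to the start of the cell, because the deviation at the exit time itself counts. *)
Definition bad (k : nat) : set Omega :=
  good k `&` one_jump X (gridpt k) h `&`
    X (gridpt k + h) @^-1` [set y | del1 < enorm (y - x (gridpt k + h))].

Let measurable_ball (z : 'rV[R]_d) r : measurable [set y | enorm (y - z) <= r].
Proof. by apply: measurable_le_set => //; apply: measurable_enorm; exact: measurable_sub. Qed.

Let measurable_coball (z : 'rV[R]_d) r : measurable [set y | r < enorm (y - z)].
Proof. by apply: measurable_lt_set => //; apply: measurable_enorm; exact: measurable_sub. Qed.

Lemma history_good k : history X (gridpt k) (good k).
Proof.
elim: k => [|k IH] /=.
  have -> : gridpt 0 = 0 by rewrite /gridpt mul0r.
  by apply: history_preimage; [rewrite lexx|exact: measurableI].
rewrite gridptS; apply: historyI; first apply: historyI.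
- by apply: history_le IH; rewrite lerDl ltW.
- exact: (history_one_jump Xstep (gridpt_ge0 k) h0).
- apply: history_preimage; last exact: measurableI.
  by rewrite lexx addr_ge0 ?gridpt_ge0// ltW.
Qed.

Lemma good_S k : good k `<=` X (gridpt k) @^-1` S.
Proof.
case: k => [|k] w /=.
  by rewrite /gridpt mul0r => -[].
by rewrite -gridptS => -[_ []].
Qed.

Lemma measurable_good k : measurable (good k).
Proof. exact: (history_measurable mX (@history_good k)). Qed.

Lemma measurable_bad k : measurable (bad k).
Proof.
apply: measurableI; first apply: measurableI.
- exact: measurable_good.
- exact: (history_measurable mX (history_one_jump Xstep (gridpt_ge0 k) h0)).
- rewrite -[X in measurable X]setTI; apply: mX => //.
  by rewrite addr_ge0 ?gridpt_ge0// ltW.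
Qed.

(* Discounting by [1 + h * L] at each step absorbs the growth of [psi] due to
   the Lipschitz drift, as in a discrete Gronwall lemma. *)
Let alpha k := a / (1 + h * L) ^+ k.

Let hL1 : 1 <= 1 + h * L. Proof. by rewrite lerDl mulr_ge0// ltW. Qed.
Let hL0 : 0 < 1 + h * L. Proof. exact: lt_le_trans hL1. Qed.

Let alphaS k : alpha k.+1 * (1 + h * L) = alpha k.
Proof. by rewrite /alpha exprSr invfM mulrA divfK// gt_eqF. Qed.

Let alpha_ge0 k : 0 <= alpha k.
Proof. by rewrite divr_ge0// exprn_ge0// ltW. Qed.

Let alpha_le k : alpha k <= a.
Proof. by rewrite ler_pdivrMr ?exprn_gt0// ler_peMr// exprn_ege1. Qed.

Let alpha_ge k : (k <= m.+1)%N -> a * expR (- (L * T)) <= alpha k.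
Proof.
move=> km; rewrite /alpha expRN ler_wpM2l// lef_pV2 ?posrE ?expR_gt0 ?exprn_gt0//.
apply: (@le_trans _ _ (expR (h * L) ^+ k)).
  apply: lerXn2r; rewrite ?nnegrE ?expR_ge0 ?expR_ge1Dx//; exact: ltW.
rewrite -expRM_natl ler_expR mulrA mulrC ler_wpM2l//.
exact: gridpt_le km.
Qed.

Let energy k w := (expR (n * alpha k * psi e (X (gridpt k) w - x (gridpt k))))%:E.
(** The summand 1 absorbs the errors of order [h^2] of a cell, thanks to [h_small]. *)
Let kappa := h * (n * a * eps + rem + 1).
(** A lower bound for the energy at any exceedance, since the discounted weights stay above
    [a * expR (- (L * T))]. *)
Let level := expR (n * (a * expR (- (L * T))) * del1).

Let measurable_energy k A : measurable_fun A (energy k).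
Proof.
rewrite /energy; apply/measurable_EFinP; apply: measurable_funTS.
apply: measurableT_comp => //; apply: measurable_funM => //.
apply: measurable_psi; apply: measurable_sub => //.
by apply: mX; exact: gridpt_ge0.
Qed.

Let energy_ge0 k w : (0 <= energy k w)%E.
Proof. by rewrite lee_fin expR_ge0. Qed.

Lemma grid_step k : (k < m.+1)%N ->
  (\int[P]_(w in good k.+1) energy k.+1 w + level%:E * P (bad k) <=
   (expR kappa)%:E * \int[P]_(w in good k) energy k w)%E.
Proof.
move=> km.
have na0 : 0 <= n * a by rewrite mulr_ge0// ltW.
have kS : gridpt k + h <= T by rewrite -gridptS gridpt_le.
have rem' : (alpha k.+1 / (2 * e) / n + alpha k.+1 ^+ 2) *
    (16 / (eta / d%:R) ^+ 2) * (2 * d%:R * C * n) <= rem.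
  apply: le_trans rem_ge.
  apply: ler_wpM2r; first by rewrite !mulr_ge0// ltW.
  apply: ler_wpM2r; first by rewrite divr_ge0// sqr_ge0.
  apply: lerD; last by rewrite ler_pXn2r ?nnegrE.
  apply: ler_wpM2r; first by rewrite invr_ge0 ltW.
  by apply: ler_wpM2r => //; rewrite invr_ge0 mulr_ge0// ltW.
have := @cell_estimate R d hd disp Omega P I S K X XP eta C n L eps (alpha k.+1) e rem
  bt eta0 C0 n0 L0 (alpha_ge0 _) (le_trans (alpha_le _) a_eta) e0 mgf drift_bt bt_lip
  rem' (gridpt k) h (x (gridpt k)) (x (gridpt k + h)) (M * h ^+ 2) (gridpt_ge0 k) h0
  (x_euler (gridpt_ge0 k) (ltW h0) kS) (good k) kappa (@history_good k) (@good_S k).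
rewrite alphaS => H; apply: le_trans (H _); last first.
  have h1 : n * alpha k.+1 <= n * a by rewrite ler_wpM2l// ltW.
  have h2 : n * alpha k.+1 * (M * h ^+ 2) <= n * a * (M * h ^+ 2).
    by rewrite ler_wpM2r// mulr_ge0// sqr_ge0.
  have h3 : h * (n * alpha k.+1 * eps) <= h * (n * a * eps).
    by rewrite ler_wpM2l ?(ltW h0)// ler_wpM2r.
  have : h * (h * (n * a * M + (C * n) ^+ 2)) < h * 1 by rewrite ltr_pM2l.
  by rewrite /kappa; lra.
have mGS := measurable_good k.+1; have mB := measurable_bad k.
have e0' w : (0 <= (expR (n * alpha k.+1 * psi e (X (gridpt k + h) w - x (gridpt k + h))))%:E)%E.
  by rewrite lee_fin expR_ge0.
have me A : measurable_fun A (fun w =>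
    (expR (n * alpha k.+1 * psi e (X (gridpt k + h) w - x (gridpt k + h))))%:E).
  by have := @measurable_energy k.+1 A; rewrite /energy gridptS.
(* Paths that leave [S] without exceeding [del1] are simply dropped, which amounts to stopping
   them. *)
apply: (@le_trans _ _ (\int[P]_(w in good k.+1 `|` bad k)
   (expR (n * alpha k.+1 * psi e (X (gridpt k + h) w - x (gridpt k + h))))%:E)%E); last first.
  apply: ge0_subset_integral => //.
  - exact: measurableU.
  - apply: measurableI; first exact: measurable_good.
    exact: (history_measurable mX (history_one_jump Xstep (gridpt_ge0 k) h0)).
  - by move=> w /= [[]|[]].
rewrite ge0_integral_setU//; last first.
  by apply/disj_setPS => w [[_ [_ /=]]] le1 [_ /=]; rewrite ltNge le1.
rewrite /energy gridptS leeD2l// -integral_cst//.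
apply: ge0_le_integral_nomeas => w; first by rewrite lee_fin expR_ge0.
move=> [_ /= dev]; rewrite lee_fin ler_expR -(mulrA n) -(mulrA n (alpha _)) ler_pM2l//.
apply: (@le_trans _ _ (a * expR (- (L * T)) * psi e (X (gridpt k + h) w - x (gridpt k + h)))).
  rewrite ler_wpM2l ?mulr_ge0 ?expR_ge0//.
  exact: le_trans (ltW dev) (enorm_le_psi _ _).
by rewrite ler_wpM2r ?psi_ge0// alpha_ge.
Qed.

(** Iteration of [grid_step]; bad mass collected earlier may be multiplied by [expR kappa >= 1], so
    it stays on the left at no cost. *)
Lemma grid_energy k : (k <= m.+1)%N -> 0 <= del0 -> 0 <= rem ->
  (\int[P]_(w in good k) energy k w + level%:E * \sum_(j < k) P (bad j) <=
   (expR (kappa * k%:R + n * a * (e + del0)))%:E)%E.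
Proof.
move=> km del00 rem0.
have kap0 : 0 <= kappa.
  by rewrite mulr_ge0 ?(ltW h0)// !addr_ge0// !mulr_ge0// ltW.
elim: k km => [_|k IH km].
  rewrite big_ord0 mule0 adde0 mulr0 add0r.
  apply: (@le_trans _ _ (\int[P]_(w in good 0) (expR (n * a * (e + del0)))%:E)%E).
    apply: ge0_le_integral_nomeas => // w /= [_ dev].
    rewrite lee_fin ler_expR /alpha expr0 divr1 ler_wpM2l//.
      by rewrite mulr_ge0// ltW.
    rewrite /gridpt mul0r; apply: le_trans (psi_le _ (ltW e0)) _.
    by rewrite lerD2l.
  rewrite integral_cst//=; last exact: (@measurable_good 0).
  rewrite -[leRHS]mule1 lee_wpmul2l ?lee_fin ?expR_ge0// probability_le1//.
  exact: (@measurable_good 0).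
rewrite big_ord_recr /= ge0_muleDr//; last exact: sume_ge0.
rewrite addeA (addeAC _ (_ * \sum_(_ < _) _)%E).
apply: le_trans (leeD2r _ (grid_step km)) _.
have ek1 : (1 <= (expR kappa)%:E)%E by rewrite lee_fin -expR0 ler_expR.
apply: (@le_trans _ _ ((expR kappa)%:E * (\int[P]_(w in good k) energy k w +
    level%:E * \sum_(j < k) P (bad j)))%E).
  have s0 : (0 <= level%:E * \sum_(j < k) P (bad j))%E.
    by rewrite mule_ge0 ?lee_fin ?expR_ge0//; exact: sume_ge0.
  have i0 : (0 <= \int[P]_(w in good k) energy k w)%E by exact: integral_ge0.
  move: i0 s0; set u := (\int[P]_(w in _) _)%E; set v := (level%:E * _)%E => i0 s0.
  by rewrite (ge0_muleDr _ i0 s0) leeD2l// -[leLHS]mul1e lee_wpmul2r.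
apply: le_trans (lee_wpmul2l _ (IH (ltnW km))) _; first by rewrite lee_fin expR_ge0.
by rewrite -EFinM -expRD lee_fin ler_expR -natr1; lra.
Qed.

Lemma grid_bad : 0 <= del0 -> 0 <= rem ->
  (P (\bigcup_(j in `I_m.+1) bad j) <=
   (expR (T * (n * a * eps + rem + 1) + n * a * (e + del0)
          - n * (a * expR (- (L * T))) * del1))%:E)%E.
Proof.
move=> del00 rem0; have := @grid_energy m.+1 (leqnn _) del00 rem0.
have -> : kappa * m.+1%:R = T * (n * a * eps + rem + 1).
  by rewrite /kappa mulrC mulrA (mulrC _ h) /h divfK.
have mb j : measurable (bad j) by exact: measurable_bad.
have mU : measurable (\bigcup_(j in `I_m.+1) bad j) by exact: bigcup_measurable.
have sub : (P (\bigcup_(j in `I_m.+1) bad j) <= \sum_(j < m.+1) P (bad j))%E.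
  by apply: content_subadditive => //; rewrite bigcup_mkord.
set lev := n * _ * del1; have lev0 : 0 < expR lev by exact: expR_gt0.
move=> H; rewrite expRD expRN -(fineK (fin_num_measure P _ mU)) lee_fin.
rewrite ler_pdivlMr// -lee_fin EFinM fineK ?fin_num_measure// muleC.
apply: le_trans H; apply: (@le_trans _ _ (level%:E * \sum_(j < m.+1) P (bad j))%E).
  by rewrite lee_wpmul2l// lee_fin expR_ge0.
by rewrite leeDr// integral_ge0.
Qed.

End grid.

(** * The deviation event *)

Section deviation.
Context {R : realType} {d : nat} {disp : measure_display}
  {Omega : measurableType disp}.
Implicit Types (s t u r e del : R) (w : Omega).
Variables (P : probability Omega R) (S : set 'rV[R]_d)
  (X : R -> Omega -> 'rV[R]_d).
Hypothesis mX : forall t, 0 <= t -> measurable_fun setT (X t).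
Hypothesis Xstep : forall w, step_path (X ^~ w).
Hypothesis mS : measurable S.
Variables (x : R -> 'rV[R]_d) (T M : R).
Hypotheses (T0 : 0 < T) (M0 : 0 <= M).
Hypothesis x_lip : forall s u, 0 <= s -> s <= u -> u <= T ->
  enorm (x u - x s) <= M * (u - s).

Definition path_dist t w : R := enorm (X t w - x t).

Lemma path_dist_le t w y : path_dist t w <= enorm (X t w - y) + enorm (x t - y).
Proof.
have := ler_enormB (X t w - x t) (X t w - y).
rewrite (_ : _ - _ - _ = - (x t - y)) ?enormN//.
by apply/rowP => i; rewrite !mxE; ring.
Qed.

Definition deviation (del : R) : set Omega := [set w |
  (nnsup [set (enorm (X t w - x t))%:E | t in
    [set t : R | (0 <= t)%R /\ t%:E <= exit_time S T (X ^~ w)]] > del%:E)%E].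

(** A time is at most the exit time exactly when the path is in [S] strictly before it. As
    [del >= 0], the value 0 added in [nnsup] never causes a deviation. *)
Lemma deviationP del w : 0 <= del -> deviation del w <->
  exists t, [/\ 0 <= t, t <= T, (forall s, 0 <= s -> s < t -> S (X s w)) &
    del < path_dist t w].
Proof.
move=> del0; split.
  rewrite /deviation /nnsup /= => /ereal_sup_gt[y [->|[t [t0 te] <-]]].
    by rewrite lte_fin ltNge del0.
  move: te; rewrite /exit_time le_min lee_fin => /andP[tinf tT].
  rewrite lte_fin => dev.
  exists t; split=> // s s0 st; apply: contrapT => nS.
  have : (t%:E <= s%:E)%E by apply: le_trans tinf _; apply: ereal_inf_lbound; exists s.
  by rewrite lee_fin leNgt st.
move=> [t [t0 tT HS dev]]; apply: (@lt_le_trans _ _ (enorm (X t w - x t))%:E).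
  by rewrite lte_fin.
apply: ereal_sup_ubound; right; exists t => //; split => //.
rewrite /exit_time le_min lee_fin tT andbT.
apply: le_ereal_inf_tmp => _ [s [s0 nS] <-]; rewrite lee_fin leNgt.
by apply/negP => st; apply: nS; exact: HS.
Qed.

Let g m k := gridpt T m k.
Let h m := T / m.+1%:R.

Let h0 m : 0 < h m. Proof. by rewrite divr_gt0. Qed.

Let gS m k : g m k.+1 = g m k + h m. Proof. exact: gridptS. Qed.

Let g0 m : g m 0 = 0. Proof. by rewrite /g /gridpt mul0r. Qed.

Let g_ge0 m k : 0 <= g m k. Proof. exact: gridpt_ge0. Qed.

Let g_le m k : (k <= m.+1)%N -> g m k <= T. Proof. exact: gridpt_le. Qed.

Let g_mono m j k : (j <= k)%N -> g m j <= g m k.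
Proof. by move=> jk; apply: ler_wpM2r; [exact/ltW/h0|rewrite ler_nat]. Qed.

Lemma grid_one_jump w : \forall m \near \oo, forall k, (k < m.+1)%N ->
  one_jump X (g m k) (h m) w.
Proof.
have [r r0 mesh] := step_path_mesh (Xstep w) T (lexx 0).
near=> m => k km u /andP[u0 uh]; apply: mesh.
- exact: g_ge0.
- by rewrite lerDl.
- by rewrite lerD2l.
- by rewrite -gS g_le.
- rewrite addrAC subrr add0r /h -ler_pdivlMl// ltW//.
  by near: m; apply: natSinv_lt; rewrite mulr_gt0 ?invr_gt0.
Unshelve. all: by end_near. Qed.

Lemma grid_fine e : 0 < e -> \forall m \near \oo, M * h m < e.
Proof.
move=> e0; have M1T : 0 < (M + 1) * T by rewrite mulr_gt0// ltr_wpDl.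
near=> m.
apply: (@le_lt_trans _ _ ((M + 1) * h m)).
  by apply: ler_wpM2r; [exact: ltW|rewrite lerDl].
rewrite /h mulrA -ltr_pdivlMl//.
by near: m; apply: natSinv_lt; rewrite mulr_gt0 ?invr_gt0.
Unshelve. all: by end_near. Qed.

Lemma cell_coords m t : 0 < t -> t <= T -> exists2 k, (k < m.+1)%N &
  exists2 u, 0 < u <= h m & t = g m k + u.
Proof.
move=> t0 tT; have [k km /andP[kt tk]] := grid_cell m t0 tT; exists k => //.
exists (t - g m k); last by rewrite addrC subrK.
by move: tk; rewrite subr_gt0 kt/= lerBlDl -gS.
Qed.

Lemma x_cell m k u : (k < m.+1)%N -> 0 <= u <= h m ->
  enorm (x (g m k + u) - x (g m k)) <= M * h m /\
  enorm (x (g m k.+1) - x (g m k + u)) <= M * h m.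
Proof.
move=> km /andP[u0 uh]; have gu : g m k + u <= g m k.+1 by rewrite gS lerD2l.
split.
  apply: le_trans (x_lip (g_ge0 m k) _ _) _; first by rewrite lerDl.
    exact: le_trans gu (g_le km).
  by rewrite ler_wpM2l// addrAC subrr add0r.
apply: le_trans (x_lip _ gu (g_le km)) _; first by rewrite addr_ge0.
by rewrite ler_wpM2l// gS; move: u0; lra.
Qed.

(** Moving from a time to an end of its cell changes the deviation by at most [M * h m]. Demanding
    an excess [r l] at grid points and taking the union over [l] of the lower limits in [m]
    therefore recovers the event exactly. *)
Lemma measurable_deviation del : 0 <= del -> measurable (deviation del).
Proof.
move=> del0.
have [r r0 r_small] : exists2 r : nat -> R, (forall l, 0 < r l) &
    forall e, 0 < e -> exists l, r l < e.
  exists (fun l => l.+1%:R^-1) => [l|e /natSinv_lt e0]; first by rewrite invr_gt0.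
  by have [l] := @filter_ex _ _ _ _ e0; exists l.
pose D l s := [set w | del + r l < path_dist s w].
have mD l s : 0 <= s -> measurable (D l s).
  move=> s0; apply: measurable_lt_set => //.
  by apply: measurable_enorm; apply: measurable_sub => //; exact: mX.
pose C l m := D l 0 `|` \bigcup_(k in `I_m.+1)
  ((\bigcap_(j in `I_k.+1) X (g m j) @^-1` S) `&` D l (g m k.+1)).
have mC l m : measurable (C l m).
  apply: measurableU; first exact: mD.
  apply: bigcup_measurable => k _; apply: measurableI; last exact: mD.
  apply: bigcap_measurableType => j _.
  by rewrite -[X in measurable X]setTI; exact: mX.
rewrite (_ : deviation del = \bigcup_l [set w | \forall m \near \oo, C l m w]).
  by apply: bigcup_measurable => l _; exact: measurable_eventually (mC l) _.
apply/seteqP; split=> w.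
  move=> /(deviationP _ del0)[t [t0 tT HS dev]].
  have gap : 0 < (path_dist t w - del) / 2 by rewrite divr_gt0// subr_gt0.
  have [l ll] := r_small _ gap; have rl := r0 l; exists l => //.
  have [t0'|t0'] := ltP 0 t; last first.
    have {t0'}E : t = 0 by apply/le_anti/andP.
    by apply: nearW => m; left; rewrite /D/= -E; lra.
  near=> m.
  have cell : forall k, (k < m.+1)%N -> one_jump X (g m k) (h m) w.
    by near: m; exact: grid_one_jump.
  have fine : M * h m < r l by near: m; exact: grid_fine.
  have [k km [u /andP[u0 uh] E]] := cell_coords m t0' tT.
  have uhm : 0 <= u <= h m by rewrite (ltW u0).
  have [x1 x2] := x_cell km uhm.
  have inS j : (j <= k)%N -> S (X (g m j) w).
    move=> jk; apply: HS => //; rewrite E.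
    apply: (@le_lt_trans _ _ (g m k)); last by rewrite ltrDl.
    exact: g_mono.
  have [|Xk|Xk] := cell k km u; first by rewrite (ltW u0).
    have Dk : D l (g m k) w.
      rewrite /D/= {1}/path_dist -Xk -E.
      by have := path_dist_le t w (x (g m k)); rewrite [in x t]E; lra.
    case: k km {x1 x2 Xk E} inS Dk => [|k] km inS Dk; first by left; rewrite -(g0 m).
    right; exists k; first exact: ltnW.
    by split => // j /= jk; apply: inS; exact: leqW.
  right; exists k => //; split; first by move=> j /= jk; exact: inS.
  rewrite /D/= gS {1}/path_dist -Xk -E.
  have := path_dist_le t w (x (g m k + h m)); rewrite (enormB (x t)) [in x t]E -gS; lra.
move=> [l _ H]; apply/(deviationP _ del0).
have l0 := r0 l.
have [m [[Cm cell] fine]] := @filter_ex _ _ _ _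
  (filterI (filterI H (grid_one_jump w)) (grid_fine l0)).
case: Cm => [D0|[k km [HS Dk]]].
  exists 0; split => //; first exact: ltW.
    by move=> s s0; rewrite ltNge s0.
  by move: D0; rewrite /D/=; lra.
have HS' j : (j <= k)%N -> S (X (g m j) w) by move=> jk; exact: HS.
have before s : 0 <= s -> s <= g m k -> S (X s w).
  rewrite le_eqVlt => /predU1P[<-|s0] sk; first by rewrite -(g0 m); exact: HS'.
  have [i im [u /andP[u0 uh] E]] := cell_coords m s0 (le_trans sk (g_le (ltnW km))).
  have ik : (i < k)%N.
    rewrite ltnNge; apply/negP => ki; move: sk; rewrite E leNgt => /negP; apply.
    apply: (@le_lt_trans _ _ (g m i)); last by rewrite ltrDl.
    exact: g_mono.
  rewrite E; have [|->|->] := cell i im u; first by rewrite (ltW u0).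
    by apply: HS'; exact: ltnW.
  by rewrite -gS; exact: HS'.
(* If the cell contains a jump, its target may lie outside [S], so the end of the cell may come
   after the exit; the jump time is used instead, where [X] already has its final value. *)
have [eqX|neqX] := pselect (X (g m k + h m) w = X (g m k) w).
  exists (g m k.+1); split; [exact: g_ge0|exact: g_le| |].
    move=> s s0 sg; have [sk|/ltW ks] := leP s (g m k); first exact: before.
    rewrite -(subrK (g m k) s) addrC; have [||->] := cell k km (s - g m k).
    - by rewrite subr_ge0 ks/= lerBlDl -gS ltW.
    - by move=> ->; exact: HS'.
    - by rewrite eqX; exact: HS'.
  by move: Dk; rewrite /D/=; lra.
have [wle _] := one_jump_wait Xstep (g_ge0 m k) (h0 m) (cell k km) neqX.
have [v [_ /andP[v0 vh] neqv const]] := jump_waitP Xstep (g_ge0 m k) wle.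
have Xr : X (g m k + v) w = X (g m k + h m) w.
  by have [|//|//] := cell k km v; rewrite (ltW v0).
have vhm : 0 <= v <= h m by rewrite (ltW v0).
have [_ x2] := x_cell km vhm.
exists (g m k + v); split.
- by rewrite addr_ge0// ltW.
- by apply: le_trans (g_le km); rewrite gS lerD2l.
- move=> s s0 sr; have [sk|/ltW ks] := leP s (g m k); first exact: before.
  rewrite -(subrK (g m k) s) addrC const; first exact: HS'.
  by rewrite subr_ge0 ks ltrBlDl.
move: Dk; rewrite /D/= gS => Dk; rewrite /path_dist Xr.
have := path_dist_le (g m k + h m) w (x (g m k + v)); rewrite -gS in Dk *; lra.
Unshelve. all: by end_near. Qed.

(** At a deviation time [X] has its value at one end of the cell while [x] moves by less than
    [del / 2] over the cell, so the deviation exceeds [del / 2] at that end. The first such grid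
    point gives a bad event. *)
Lemma deviation_bad del (del0 : R) w : 0 < del -> del0 <= del / 2 ->
  deviation del w -> path_dist 0 w <= del0 ->
  \forall m \near \oo, (\bigcup_(j in `I_m.+1) bad S X x T del0 (del / 2) m j) w.
Proof.
move=> del_gt0 del0_le /(deviationP _ (ltW del_gt0))[t [t0 tT HS dev]] start.
have {t0}t0 : 0 < t.
  rewrite lt_def t0 andbT; apply/eqP => E; move: dev; rewrite E; lra.
near=> m.
have cell : forall k, (k < m.+1)%N -> one_jump X (g m k) (h m) w.
  by near: m; exact: grid_one_jump.
have fine : M * h m < del / 2 by near: m; apply: grid_fine; rewrite divr_gt0.
have [k km [u /andP[u0 uh] E]] := cell_coords m t0 tT.
have uhm : 0 <= u <= h m by rewrite (ltW u0).
  have [x1 x2] := x_cell km uhm.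
have inS j : (j <= k)%N -> S (X (g m j) w).
  move=> jk; apply: HS => //; rewrite E.
  apply: (@le_lt_trans _ _ (g m k)); last by rewrite ltrDl.
  exact: g_mono.
apply: contrapT => nbad.
have goodk j : (j <= k)%N -> good S X x T del0 (del / 2) m j w.
  elim: j => [_|j IH jk] /=; first by split=> //; rewrite -(g0 m); exact: inS.
  split; first by split; [exact/IH/ltnW|apply: cell; exact: ltn_trans km].
  split; first by have := inS _ jk; rewrite /= gS.
  rewrite /= leNgt; apply/negP => far.
  apply: nbad; exists j; first exact: ltn_trans km.
  split=> //; split; first exact/IH/ltnW.
  by apply: cell; exact: ltn_trans km.
have devk : path_dist (g m k) w <= del / 2.
  case: k {km E x1 x2 inS} goodk => [|k] goodk.
    by rewrite g0; exact: le_trans start del0_le.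
  by have [_ [_]] := goodk _ (leqnn _); rewrite /= gS.
have devk1 : path_dist (g m k + h m) w <= del / 2.
  rewrite leNgt; apply/negP => far; apply: nbad; exists k => //.
  by split=> //; split; [exact: goodk|exact: cell].
have xt y : path_dist t w <= enorm (X t w - y) + enorm (x t - y) by exact: path_dist_le.
have [|Xk|Xk] := cell k km u; first by rewrite (ltW u0).
  have := xt (x (g m k)); rewrite E Xk -[enorm (X _ w - _)]/(path_dist _ w) -E => h1.
  by move: x1; rewrite -E; lra.
have := xt (x (g m k + h m)); rewrite E Xk -[enorm (X _ w - _)]/(path_dist _ w) -E => h1.
by move: x2; rewrite enormB -E gS; lra.
Unshelve. all: by end_near. Qed.

(** Fatou's lemma for sets: apart from a far start, the deviation lies in the lower limit of the bad
    events, the increasing union of the sets [F n]. *)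
Lemma deviation_le del (del0 : R) (q : \bar R) : 0 < del -> del0 <= del / 2 ->
  (forall m k, measurable (bad S X x T del0 (del / 2) m k)) ->
  (\forall m \near \oo,
    (P (\bigcup_(j in `I_m.+1) bad S X x T del0 (del / 2) m j) <= q)%E) ->
  (P (deviation del) <= P [set w | (del0 < enorm (X 0%R w - x 0%R))%R] + q)%E.
Proof.
move=> del_gt0 del0_le mbad Pbad.
pose B m := \bigcup_(j in `I_m.+1) bad S X x T del0 (del / 2) m j.
have mB m : measurable (B m) by exact: bigcup_measurable.
pose F n := \bigcap_(m in [set m | (n <= m)%N]) B m.
have mF n : measurable (F n) by exact: bigcap_measurableType.
have ndF : nondecreasing_seq F.
  move=> n n' nn'; apply/subsetPset => w Fw m /= n'm.
  by apply: Fw; exact: leq_trans n'm.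
have mUF : measurable (\bigcup_n F n) by exact: bigcup_measurable.
have PF : (P (\bigcup_n F n) <= q)%E.
  have cv : (P \o F) @ \oo --> P (\bigcup_n F n) by exact: nondecreasing_cvg_mu.
  rewrite -(cvg_lim _ cv)//; apply: lime_le; first exact: cvgP cv.
  near=> n; apply: (@le_trans _ _ (P (B n))).
    by apply: le_measure; rewrite ?inE// => w; apply => /=.
  by near: n; exact: Pbad.
have m0 : measurable [set w | del0 < enorm (X 0 w - x 0)].
  apply: measurable_lt_set => //.
  by apply: measurable_enorm; apply: measurable_sub => //; exact: mX.
apply: (@le_trans _ _ (P ([set w | (del0 < enorm (X 0 w - x 0))%R] `|` \bigcup_n F n))).
  apply: le_measure; rewrite ?inE//.
  - exact/measurable_deviation/ltW.
  - exact: measurableU.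
  - move=> w Dw; have [start|far] := leP (path_dist 0 w) del0; last by left.
    by right; have [n _ Hn] := deviation_bad del_gt0 del0_le Dw start; exists n.
by apply: le_trans (measureU2 _ _ _) _ => //; rewrite leeD2l.
Unshelve. all: by end_near. Qed.

End deviation.

(** * Exponential rates *)

Section exponential_rates.
Context {R : realType}.
Implicit Types (u : nat -> \bar R).
Local Open Scope ereal_scope.

Lemma limn_esup_lt0 u : limn_esup u < 0 ->
  exists2 c : R, (0 < c)%R & \forall n \near \oo, u n <= (- c)%:E.
Proof.
move=> /ereal_inf_lt[_ [A /= FA <-] supA].
have [c c0 Ac] : exists2 c : R, (0 < c)%R & ereal_sup (u @` A) <= (- c)%:E.
  case: (ereal_sup (u @` A)) supA => [r||]// r0.
    by exists (- r)%R; rewrite ?opprK// oppr_gt0 -lte_fin.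
  (* The supremum is -oo, as when all the probabilities vanish; any rate works. *)
  by exists 1%R => //; exact: leNye.
exists c => //; apply: filterS FA => n An.
by apply: le_trans Ac; apply: ereal_sup_ubound; exists n.
Qed.

Lemma limn_esup_le u (l : \bar R) :
  (\forall n \near \oo, u n <= l) -> limn_esup u <= l.
Proof.
move=> ul; apply: (@le_trans _ _ (ereal_sup (u @` [set n | u n <= l]))).
  by apply: ereal_inf_lbound; exists [set n | u n <= l].
by apply: ge_ereal_sup => _ [n /= un <-].
Qed.

Lemma lne_le_expR (p : \bar R) (n c : R) : (0 < n)%R -> p \is a fin_num ->
  (n^-1)%:E * lne p <= (- c)%:E -> p <= (expR (- (c * n)))%:E.
Proof.
case: p => [p||]// n0 _; rewrite /lne; case: ifPn => [p0 _|].
  by rewrite lee_fin (le_trans p0)// expR_ge0.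
rewrite -ltNge => p0; rewrite -EFinM !lee_fin ler_pdivrMl// => h.
by rewrite -[p]lnK ?posrE// ler_expR; move: h; lra.
Qed.

Lemma expR_le_lne (p : \bar R) (n c : R) : (0 < n)%R -> 0 <= p ->
  p <= (expR (- (c * n)))%:E -> (n^-1)%:E * lne p <= (- c)%:E.
Proof.
case: p => [p||]// n0 p0; rewrite /lne; case: ifPn => [_ _|].
  by rewrite gt0_muleNy ?lte_fin ?invr_gt0// leNye.
rewrite -ltNge => p0'; rewrite -EFinM !lee_fin ler_pdivrMl// => h.
by have := ler_ln p0' (expR_gt0 (- (c * n))); rewrite h expRK => /esym; lra.
Qed.

End exponential_rates.

(** * The deviation bound for a single process, after refinement of the grid *)

Section fixed_process.
Context {R : realType} {d : nat} (hd : (0 < d)%N) {disp : measure_display}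
  {Omega : measurableType disp}.
Variables (P : probability Omega R) (I S : set 'rV[R]_d)
  (K : R.-ker 'rV[R]_d ~> 'rV[R]_d) (X : R -> Omega -> 'rV[R]_d).
Hypothesis XP : pure_jump_markov P I K X.
Variables (eta C n L eps a e rem : R) (bt : 'rV[R]_d -> 'rV[R]_d).
Hypotheses (eta0 : 0 < eta) (C0 : 0 <= C) (n0 : 0 < n) (L0 : 0 <= L)
  (a0 : 0 <= a) (a_eta : a <= eta / d%:R / 2) (e0 : 0 < e) (eps0 : 0 <= eps).
Hypothesis mgf : forall x theta, (I `&` S) x -> enorm theta <= eta ->
  (\int[K x]_y (expR (dotv (n *: theta) y))%:E <= (C * n)%:E)%E.
Hypothesis drift_bt : forall x, (I `&` S) x -> enorm (drift K x - bt x) <= eps.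
Hypothesis bt_lip : forall x y, enorm (bt x - bt y) <= L * enorm (x - y).
Hypothesis rem_ge : (a / (2 * e) / n + a ^+ 2) * (16 / (eta / d%:R) ^+ 2) *
  (2 * d%:R * C * n) <= rem.
Hypothesis mS : measurable S.
Variables (x : R -> 'rV[R]_d) (p0 : 'rV[R]_d) (T : R).
Hypotheses (T0 : 0 < T) (sol : ode_solution bt p0 x).

Lemma deviation_prob_le (del del0 : R) : 0 < del -> 0 <= del0 ->
  del0 <= del / 2 -> 0 <= rem ->
  (P (deviation S X x T del) <= P [set w | (del0 < enorm (X 0%R w - x 0%R))%R] +
   (expR (T * (n * a * eps + rem + 1) + n * a * (e + del0)
          - n * (a * expR (- (L * T))) * (del / 2)))%:E)%E.
Proof.
move=> del_gt0 del00 del0_le rem0.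
have [M M0 [xlip xeuler]] := ode_increment L0 bt_lip sol T0.
apply: (deviation_le (pjm_measurable XP) (pjm_paths XP) mS T0 M0 xlip) => //.
  by move=> m k; exact: (measurable_bad XP mS).
pose c := n * a * M + (C * n) ^+ 2 + 1.
have c0 : 0 < c.
  by rewrite ltr_wpDl// addr_ge0 ?sqr_ge0// !mulr_ge0// ltW.
near=> m.
apply: (grid_bad hd XP eta0 C0 n0 L0 a0 a_eta e0 eps0 mgf drift_bt bt_lip rem_ge
  mS (del / 2) T0 M0 xeuler) => //.
apply: (@lt_trans _ _ (T / m.+1%:R * c)).
  by rewrite ltr_pM2l ?divr_gt0// /c ltrDl.
rewrite mulrAC ltr_pdivrMr// mul1r -ltf_pV2 ?posrE ?mulr_gt0//.
by near: m; apply: natSinv_lt; rewrite invr_gt0 mulr_gt0.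
Unshelve. all: by end_near. Qed.

End fixed_process.

(** * Choice of the constants and exponential decay *)

Theorem proposition5p1 (R : realType) (d : nat) (hd : (0 < d)%N)
  (disp : nat -> measure_display)
  (Omega : forall N, measurableType (disp N))
  (P : forall N, probability (Omega N) R)
  (I : nat -> set 'rV[R]_d)
  (hI : forall N, (0 < N)%N -> measurable (I N))
  (K : nat -> R.-ker 'rV[R]_d ~> 'rV[R]_d)
  (X : forall N, R -> Omega N -> 'rV[R]_d)
  (hX : forall N, (0 < N)%N -> pure_jump_markov (P N) (I N) (K N) (X N))
  (S : set 'rV[R]_d) (hS : open S)
  (h1 : exists2 eta0 : R, 0 < eta0 &
    (nnsup [set r | exists N x theta,
       [/\ (0 < N)%N, (I N `&` S) x, (enorm theta <= eta0)%R &
           r = (N%:R^-1)%:E * laplace (K N) x (N%:R *: theta)]] < +oo)%E)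
  (b : 'rV[R]_d -> 'rV[R]_d) (hb : lipschitz_field S b)
  (h2 : nnsup [set (enorm (drift (K N) x - b x))%:E | x in I N `&` S]
          @[N --> \oo] --> 0%E)
  (x0 : 'rV[R]_d) (hx0 : closure S x0)
  (h3 : forall delta : R, 0 < delta ->
    (limn_esup (fun N => (N%:R^-1)%:E *
       lne (P N [set w | (enorm (X N 0%R w - x0) > delta)%R])) < 0)%E)
  (bt : 'rV[R]_d -> 'rV[R]_d) (hbt : lipschitz_field setT bt)
  (hbtb : forall x, S x -> bt x = b x)
  (x : R -> 'rV[R]_d) (hx : ode_solution bt x0 x)
  (t0 : R) (ht0 : 0 < t0) (delta : R) (hdelta : 0 < delta) :
  (limn_esup (fun N => (N%:R^-1)%:E *
     lne (P N [set w |
       nnsup [set (enorm (X N t w - x t))%:E | t in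
         [set t : R | (0 <= t)%R /\ t%:E <= exit_time S t0 (X N ^~ w)]]
       > delta%:E])) < 0)%E.
Proof.
(* The definition of Lipschitz fields does not impose the sign of the constant. *)
have [L0' hL'] := hbt; pose L := Num.max L0' 0.
have L0 : 0 <= L by rewrite le_max lexx orbT.
have bt_lip u v : enorm (bt u - bt v) <= L * enorm (u - v).
  apply: le_trans (hL' u v _ _) _ => //.
  by rewrite ler_wpM2r ?enorm_ge0// le_max lexx.
have mS := open_measurable_rV hS.
have [eta eta0 hsup] := h1.
pose A1 := [set r | exists N x theta,
  [/\ (0 < N)%N, (I N `&` S) x, (enorm theta <= eta)%R &
      r = (N%:R^-1)%:E * laplace (K N) x (N%:R *: theta)]%E].
have [C C0 mgf] : exists2 C : R, 0 <= C & forall N x theta, (0 < N)%N ->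
    (I N `&` S) x -> enorm theta <= eta ->
    (\int[K N x]_y (expR (dotv (N%:R *: theta) y))%:E <= (C * N%:R)%:E)%E.
  have s0 : (0 <= nnsup A1)%E by apply: ereal_sup_ubound; left.
  have sfin : nnsup A1 \is a fin_num by rewrite ge0_fin_numE.
  exists (fine (nnsup A1)); first exact: fine_ge0.
  move=> N y theta N0 IS th.
  have N0' : 0 < N%:R :> R by rewrite ltr0n.
  have : ((N%:R^-1)%:E * laplace (K N) y (N%:R *: theta) <= (fine (nnsup A1))%:E)%E.
    by rewrite fineK//; apply: ereal_sup_ubound; right; exists N, y, theta.
  by rewrite lee_pdivrMl// muleC -EFinM.
have drift_near (r : R) : 0 < r -> \forall N \near \oo, forall y, (I N `&` S) y ->
    enorm (drift (K N) y - bt y) <= r.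
  move=> r0; have : nbhs (0%E : \bar R) [set y | (y < r%:E)%E].
    by apply: open_nbhs_nbhs; split; [exact: open_ereal_lt_ereal|rewrite /= lte_fin].
  move=> /h2 H; have {}H : \forall N \near \oo,
    (nnsup [set (enorm (drift (K N) x - b x))%:E | x in I N `&` S] < r%:E)%E by exact: H.
  apply: filterS H => N Nr y IS; rewrite -lee_fin ltW//.
  apply: le_lt_trans Nr; apply: ereal_sup_ubound; right; exists y => //.
  by rewrite hbtb//; case: IS.
have d0 : 0 < d%:R :> R by rewrite ltr0n.
pose s := eta / d%:R; have s0 : 0 < s by rewrite divr_gt0.
(* The gain in the exponent is [N * a * q]; every loss is made a fraction of it. *)
pose q := expR (- (L * t0)) * (delta / 2).
have q0 : 0 < q by rewrite mulr_gt0 ?expR_gt0// divr_gt0.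
have qdelta : q <= delta / 2.
  by rewrite ler_piMl ?divr_ge0 ?(ltW hdelta)// -expR0 ler_expR oppr_le0 mulr_ge0// ltW.
pose C3 := 16 / s ^+ 2 * (2 * d%:R * C).
have C30 : 0 <= C3 by rewrite mulr_ge0 ?divr_ge0 ?sqr_ge0// !mulr_ge0.
(* The first bound keeps the exponential moments finite, the second makes the quadratic loss
   [t0 * C3 * a ^+ 2] at most [a * q / 4]. *)
pose a := Num.min (s / 2) (q / (4 * (t0 * C3 + 1))).
have c40 : 0 < 4 * (t0 * C3 + 1) by rewrite mulr_gt0// ltr_wpDl// mulr_ge0// ltW.
have a0 : 0 < a by rewrite lt_min !divr_gt0.
have a_s : a <= s / 2 by rewrite ge_min lexx.
have a_C3 : a * (4 * (t0 * C3 + 1)) <= q by rewrite -ler_pdivlMr// ge_min lexx orbT.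
have q80 : 0 < q / 8 by rewrite divr_gt0.
(* The part of the exponent that does not grow with [N]; [q / 8] serves both as the smoothing
   parameter and as the tolerance on the starting point. *)
pose B := t0 * (C3 * (a / (2 * (q / 8))) + 1).
have B0 : 0 <= B.
  by rewrite mulr_ge0 ?(ltW ht0)// addr_ge0// mulr_ge0// divr_ge0 ?mulr_ge0// ltW.
pose rem N : R := (a / (2 * (q / 8)) / N%:R + a ^+ 2) * (16 / s ^+ 2) * (2 * d%:R * C * N%:R).
have eps0 : 0 < q / (8 * t0) by rewrite divr_gt0// mulr_gt0.
have xx0 : x 0 = x0 by case: hx.
have [c c0 hc] := limn_esup_lt0 (h3 _ q80).
pose c' := Num.min c (a * q / 4).
have aq80 : 0 < a * q / 8 by rewrite divr_gt0// mulr_gt0.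
have c'0 : 0 < c' by rewrite lt_min c0 divr_gt0// mulr_gt0.
suff key : \forall N \near \oo, ((N%:R^-1)%:E * lne (P N (deviation S (X N) x t0 delta)) <=
    (- (c' / 2))%:E)%E.
  by apply: le_lt_trans (limn_esup_le key) _; rewrite lte_fin oppr_lt0 divr_gt0.
near=> N.
have N0 : (0 < N)%N by near: N; exists 1%N.
have n0 : 0 < N%:R :> R by rewrite ltr0n.
have XP := hX N N0.
have dN : forall y, (I N `&` S) y -> enorm (drift (K N) y - bt y) <= q / (8 * t0).
  by near: N; exact: drift_near.
have remE : rem N = C3 * (a / (2 * (q / 8))) + C3 * a ^+ 2 * N%:R.
  by rewrite /rem /C3; field; rewrite !gt_eqF// ?mulr_gt0.
have rem0 : 0 <= rem N.
  rewrite remE; apply: addr_ge0.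
    by apply: mulr_ge0 => //; rewrite divr_ge0 ?(ltW a0)// mulr_ge0// ltW.
  by apply: mulr_ge0 => //; apply: mulr_ge0 => //; exact: sqr_ge0.
have q8d : q / 8 <= delta / 2 by move: q0 qdelta; lra.
have := deviation_prob_le hd XP eta0 C0 n0 L0 (ltW a0) a_s q80 (ltW eps0)
  (fun y th => mgf N y th N0) dN bt_lip (lexx (rem N)) mS ht0 hx hdelta (ltW q80) q8d rem0.
rewrite xx0; set far := (X in (_ <= X + _)%E); set E := expR _.
(* In units of [N * a * q], the losses are 1/8 for the drift, 1/4 for the quadratic term, 1/8 for
   [B] and 1/4 for smoothing and start, against a gain of 1. *)
have E1 : E <= expR (- (a * q / 4 * N%:R)).
  have bigN : B <= N%:R * (a * q / 8).
    rewrite -ler_pdivrMr//.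
    by near: N; exact: nbhs_infty_ger.
  rewrite /E ler_expR.
  have aC : t0 * C3 * a ^+ 2 <= a * q / 4.
    have := ler_wpM2l (ltW a0) a_C3; have := mulr_gt0 a0 a0; lra.
  have t0e : t0 * (N%:R * a * (q / (8 * t0))) = N%:R * (a * q / 8).
    by field; rewrite gt_eqF.
  have qE : N%:R * (a * expR (- (L * t0))) * (delta / 2) = N%:R * (a * q).
    by rewrite /q; ring.
  have := ler_wpM2l (ltW n0) aC.
  rewrite qE remE !(mulrDr t0) t0e; move: bigN; rewrite /B (mulrDr t0); lra.
have far1 : (far <= (expR (- (c * N%:R)))%:E)%E.
  apply: lne_le_expR => //; last by rewrite /far; near: N; exact: hc.
  rewrite /far; apply: fin_num_measure; apply: measurable_lt_set => //.
  apply: measurable_enorm; apply: measurable_sub => //.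
  exact: pjm_measurable XP _ (lexx 0).
move=> PE; apply: expR_le_lne => //.
apply: le_trans PE _; rewrite -lee_fin in E1; apply: le_trans (leeD far1 E1) _.
rewrite -EFinD lee_fin.
have cc : expR (- (c * N%:R)) <= expR (- (c' * N%:R)).
  by rewrite ler_expR lerN2 ler_pM2r// ge_min lexx.
have ca : expR (- (a * q / 4 * N%:R)) <= expR (- (c' * N%:R)).
  by rewrite ler_expR lerN2 ler_pM2r// ge_min lexx orbT.
apply: le_trans (lerD cc ca) _.
(* Half of the rate is given up to absorb the factor 2 from adding two exponentials. *)
have half : expR (- (c' * N%:R)) = expR (- (c' / 2 * N%:R)) * expR (- (c' / 2 * N%:R)).
  by rewrite -expRD; congr expR; field.
have small : expR (- (c' / 2 * N%:R)) <= 1 / 2.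
  rewrite expRN -[1 / 2]invrK lef_pV2 ?posrE ?expR_gt0//.
  rewrite div1r invrK; have := expR_ge1Dx (c' / 2 * N%:R).
  have : 2 / c' <= N%:R by near: N; exact: nbhs_infty_ger.
  rewrite ler_pdivrMr//; lra.
have := ler_wpM2l (expR_ge0 (- (c' / 2 * N%:R))) small.
rewrite half; lra.
Unshelve. all: by end_near. Qed.
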